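(* (i) Let $n\ge 2$ and let $\mathcal{C}=\{0,\ell e_n,w_1,\dots,w_n\}\subset\mathbb{Z}^n$ (with $\ell\geq 1$ an integer) be a primitive circuit such that no $w_i$ ($1\le i\le n$) lies in $\mathbb{R}e_n$, and let $\nu$ be the associated integer defined in the context. Then the number of real solutions of any generic system with support $\mathcal{C}$ is at most $2\nu+1$. This bound is sharp: for all integers $n,\nu$ with $2\le \nu\le n$ there exist such a primitive circuit $\mathcal{C}\subset\mathbb{Z}^n$ with this value of $\nu$ and a generic system with support $\mathcal{C}$ having exactly $2\nu+1$ real solutions. (ii) Let $n\ge 1$. Every generic system with support a primitive circuit in $\mathbb{Z}^n$ has at most $2n+1$ real solutions, and this bound is sharp: there exist a primitive circuit in $\mathbb{Z}^n$ and a generic system with this support having exactly $2n+1$ real solutions. (iii) If $\mathcal{C}\subset\mathbb{Z}^n$ is a primitive circuit and some generic system with support $\mathcal{C}$ has exactly $2n+1$ real solutions, then $\mathcal{C}$ is non-degenerate.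
   Context: A circuit in $\mathbb{Z}^n$ is a (possibly degenerate) collection of $n+2$ integer vectors of $\mathbb{Z}^n$ whose affine span is $\mathbb{R}^n$. It is non-degenerate if no proper subset of it is affinely dependent. A finite set $\mathcal{A}\subset\mathbb{Z}^n$ is primitive if it affinely spans $\mathbb{Z}^n$ over the integers (when $0\in\mathcal{A}$, this means that the integer linear combinations of elements of $\mathcal{A}$ give all of $\mathbb{Z}^n$). $e_n$ denotes the $n$th standard basis vector. A system with support $\mathcal{A}$ is a system $f_1=\dots=f_n=0$ of $n$ real Laurent polynomials in $n$ variables, the exponent vectors of the monomials of each $f_i$ lying in $\mathcal{A}$. It is generic if its number of solutions in $(\mathbb{C}^* )^n$ equals $v(\mathcal{A})$, the volume of the convex hull of $\mathcal{A}$ normalized so that $[0,1]^n$ has volume $n!$; all solutions are then simple. Real solutions are solutions in $(\mathbb{R}^* )^n$. Definition of $\nu$ in (i): write $w_i=v_i+l_ie_n$ with $0\ne v_i\in\mathbb{Z}^{n-1}$ (the first $n-1$ coordinates) and $l_i\in\mathbb{Z}$. The vectors $v_1,\dots,v_n$ generate $\mathbb{Z}^{n-1}$ and satisfy a linear relation $\sum_{i=1}^n\alpha_iv_i=0$ with coprime integer coefficients, unique up to sign. Then $\nu$ is the number of $i$ with $\alpha_i\neq 0$. *)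

(* Defs.v *)
From HB Require Import structures.
From mathcomp Require Import all_boot all_order all_algebra finmap.
From mathcomp Require Import all_classical all_reals all_analysis.
From mathcomp Require Import complex.

Set Implicit Arguments.
Unset Strict Implicit.
Unset Printing Implicit Defensive.

Import Order.TTheory GRing.Theory Num.Theory.

Local Open Scope classical_set_scope.
Local Open Scope card_scope.
Local Open Scope ring_scope.

Section Configurations.
Variables (n : nat).
Implicit Types A B C : {fset 'rV[int]_n}.

Definition affine_span (K : pzRingType) A : set 'rV[K]_n :=
  [set x | exists2 c : 'rV[int]_n -> K,
     \sum_(a <- A) c a = 1 & x = \sum_(a <- A) c a *: map_mx intr a].
Arguments affine_span K A : clear implicits.

(* For K = int the embedding intr is the identity of int (intz). *)
Definition primitive A : Prop := affine_span int A = [set: 'rV[int]_n].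

Definition convex_hull (R : realType) A : set 'rV[R]_n :=
  [set x | exists c : 'rV[int]_n -> R,
     [/\ forall a, a \in A -> 0 <= c a, \sum_(a <- A) c a = 1
       & x = \sum_(a <- A) c a *: map_mx intr a]].

Definition affinely_dependent (K : fieldType) B : Prop :=
  exists c : 'rV[int]_n -> K,
    [/\ exists2 a, a \in B & c a != 0, \sum_(a <- B) c a = 0
      & \sum_(a <- B) c a *: map_mx intr a = 0 :> 'rV[K]_n].

Definition is_circuit (R : realType) C : Prop :=
  #|` C| = n.+2 /\ affine_span R C = [set: 'rV[R]_n].

Definition nondegenerate_config (R : realType) C : Prop :=
  forall B, (B `<` C)%fset -> ~ affinely_dependent R B.

End Configurations.

Arguments affine_span {n} K A.
Arguments convex_hull {n} R A.

(* Lebesgue measure on R^n as the n-fold product of the Lebesgue measure on R;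
   the successor case is the definition of product_measure1, transported along
   the identification of R * R^n with R^n.+1. *)
Fixpoint lebesgue_rV (R : realType) (n : nat) : set 'rV[R]_n -> \bar R :=
  match n return set 'rV[R]_n -> \bar R with
  | 0 => fun A => (\1_A (0 : 'rV[R]_0) : R)%:E
  | m.+1 => fun A => (\int[lebesgue_measure]_(t in [set: R])
      lebesgue_rV [set y : 'rV[R]_m | A (row_mx (const_mx t : 'rV[R]_1) y)])%E
  end.

Definition normalized_volume (R : realType) (n : nat)
    (A : {fset 'rV[int]_n}) : \bar R :=
  (n`!%:R%:E * lebesgue_rV (convex_hull R A))%E.

(* A Laurent polynomial in n variables, as a finitely supported map from
   exponent vectors to coefficients. *)
Notation laurent R n := {fsfun 'rV[int]_n -> R with 0}.

Section Systems.
Variables (R : realType) (n : nat).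
Implicit Types (f : laurent R n) (F : 'I_n -> laurent R n).

Definition laurent_eval (K : fieldType) (iota : R -> K) f (x : 'rV[K]_n) : K :=
  \sum_(a <- finsupp f) iota (f a) * \prod_(j < n) x 0 j ^ a 0 j.

Definition torus_solutions (K : fieldType) (iota : R -> K) F : set 'rV[K]_n :=
  [set x : 'rV[K]_n |
     (forall j, x 0 j != 0) /\ (forall i, laurent_eval iota (F i) x = 0)].

Definition real_solutions F : set 'rV[R]_n := torus_solutions idfun F.

Definition complex_solutions F : set 'rV[R[i]]_n :=
  torus_solutions (real_complex R) F.

Definition has_support (A : {fset 'rV[int]_n}) F : Prop :=
  forall i, (finsupp (F i) `<=` A)%fset.

Definition generic_system (A : {fset 'rV[int]_n}) F : Prop :=
  has_support A F /\
  exists2 N : nat, complex_solutions F #= `I_N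
                 & N%:R%:E = normalized_volume R A.

End Systems.

Definition e_last (K : pzRingType) (n : nat) : 'rV[K]_n :=
  \row_(j < n) (j == n.-1 :> nat)%:R.

Arguments e_last K n : clear implicits.

Definition first_coords (n : nat) (w : 'rV[int]_n) : 'rV[int]_n.-1 :=
  \row_(j < n.-1) w 0 (widen_ord (leq_pred n) j).

Definition vertical_config (n : nat) (l : int) (w : 'I_n -> 'rV[int]_n) :
    {fset 'rV[int]_n} :=
  ([fset 0%R; (l *: e_last int n)%R] `|` [fset w i | i in 'I_n])%fset.

Definition off_vertical_axis (R : realType) (n : nat)
    (w : 'I_n -> 'rV[int]_n) : Prop :=
  forall (i : 'I_n) (t : R), map_mx intr (w i) <> t *: e_last R n.

Definition coprime_relation (n : nat) (w : 'I_n -> 'rV[int]_n)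
    (alpha : 'I_n -> int) : Prop :=
  \sum_(i < n) alpha i *: first_coords (w i) = 0 /\
  \big[gcdn/0%N]_(i < n) `|alpha i|%N = 1%N.

(* The integer nu; coprime_relation determines alpha up to sign when w comes
   from a primitive circuit. *)
Definition relation_length (n : nat) (alpha : 'I_n -> int) : nat :=
  #|[set i : 'I_n | alpha i != 0]%SET|.

(* Main.v *)
Require Import Defs.
From HB Require Import structures.
From mathcomp Require Import all_boot all_order all_algebra finmap.
From mathcomp Require Import all_classical all_reals all_analysis.
From mathcomp Require Import complex.
From mathcomp Require Import ring lra zify.
From mathcomp Require polyrcf.

(* Upper bounds.  Number the circuit a_0, ..., a_(n+1) and let lam be the
   generator of its lattice of integer affine relations; not all lam_k are even.
   By primitivity the torus embeds, through x |-> z with z_k = x^(a_k - a_i0),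
   onto the points with z_i0 = 1 and prod z_k^lam_k = 1, and the system becomes
   a linear system in z.  Finiteness of the complex solutions forces its
   solutions with z_i0 = 1 onto a line z = y + t v, so that real solutions are
   the t with prod (y_k + t v_k)^lam_k = 1.  The numerator of the logarithmic
   derivative times prod (t - c_k), c_k the zeros of the factors, has a root
   between any two of them, and the factor of a c_k with lam_k odd can be
   omitted since the product changes sign there.  With s nonzero lam_k this
   gives at most 2 s - 3 real solutions.

   Sharpness.  The circuit 0, e_0, ..., e_(n-1), w, where
   w + 2 (sum of nu - 1 of the e_j, j > 0) = (2 nu + 1) e_0, leads to an
   equation (s + 1) s^2 prod (s - i)^2 = eps, all of whose 2 nu + 1 roots are
   real and simple for small eps, and its convex hull is a simplex of normalized
   volume 2 nu + 1. *)

Set Implicit Arguments.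
Unset Strict Implicit.
Unset Printing Implicit Defensive.

Import Order.TTheory GRing.Theory Num.Theory.

Local Open Scope classical_set_scope.
Local Open Scope card_scope.
Local Open Scope ring_scope.

(** * Level sets of products of powers of linear forms *)

(** The base point i0 is chosen with lam_i0 odd. The lam_k sum to zero, so a second exponent is odd
    as well. Along the line the factor of i0 is constant; if all the other s - 1 factors of the
    support move, one of them has odd exponent, and otherwise at most s - 2 move. Both cases lead to
    2 s - 3, and s <= n + 2 in general, s <= nu + 2 in (i), turn this into the two bounds. The
    obstacle is the step from finitely many complex solutions to a line. A plane of solutions of the
    linear system has to meet prod z_k^lam_k = 1 in infinitely many points near a given one. This is
    a statement on continuity of roots, obtained by factoring a polynomial over the complex numbers
    and bounding its growth when it has no small root. For sharpness, all roots of the final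
    equation already lie in [R], so one count, made over an arbitrary extension field, serves for
    the complex solutions (genericity) and for the real ones. *)

Lemma leq_size_roots_between (R : realFieldType) (p : {poly R}) (ss : seq R) :
  p != 0 -> sorted <%R ss ->
  (forall a b, a \in ss -> b \in ss -> a < b ->
     exists2 r, a < r < b & root p r) ->
  (size ss <= size p)%N.
Proof.
move=> p0; case: ss => // a s; rewrite /sorted => a_s between.
(* Keeping all chosen roots above the head [a] lets the induction add a root between [a] and [b]
   that differs from the later ones. *)
rewrite [size _]/=; suff [rs [<- prs _ rs_uniq]] : exists rs : seq R,
  [/\ size rs = size s, all (root p) rs,
    all (fun r => a < r) rs & uniq rs] by exact: max_poly_roots.
elim: s a a_s between => [|b s IH] a; first by exists [::].
move=> /= /andP[ab b_s] between.
have [|rs [srs prs brs urs]] := IH b b_s.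
  by move=> x y xs ys; apply: between; rewrite inE ?xs ?ys orbT.
have [||r /andP[ar rb] pr] := between a b _ _ ab; rewrite ?inE ?eqxx ?orbT //.
exists (r :: rs); rewrite /= srs pr prs ar urs /= andbT; split=> //.
  by apply/allP => x /(allP brs); exact: lt_trans.
by apply/negP => /(allP brs); rewrite ltNge ltW.
Qed.

Lemma exprz_odd_lt0 (R : realFieldType) (x : R) (e : int) :
  odd `|e|%N -> x < 0 -> x ^ e < 0.
Proof.
by case: e => k ok x0; [rewrite -exprnP exprn_odd_lt0
  | rewrite NegzE -exprnN invr_lt0 exprn_odd_lt0].
Qed.

Section RationalProducts.
Variables (R : realType) (I : finType) (c : I -> R) (lam : I -> int).
Implicit Types (K J : {set I}) (t : R).

Definition rprod K t : R := \prod_(k in K) (t - c k) ^ lam k.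

(** The common denominator has one factor for each index, even when some c_k coincide; this gives
    the uniform bound [#|K|] on the size. *)
Definition lognum K : {poly R} :=
  \sum_(k in K) (lam k)%:~R *: \prod_(j in K :\ k) ('X - (c j)%:P).

Lemma is_derive_exprz (a t : R) (e : int) : t != a ->
  is_derive t 1 (fun s => (s - a) ^ e) ((t - a) ^ e * (e%:~R / (t - a))).
Proof.
move=> ta; have ta0 : t - a != 0 by rewrite subr_eq0.
have d1 : is_derive t 1 (fun s : R => s - a) 1.
  have -> : (fun s : R => s - a) = id - cst a by apply/funext.
  by apply: is_derive_eq; rewrite subr0.
have dX m : is_derive t 1 (fun s : R => (s - a) ^+ m)
    ((t - a) ^+ m * (m%:R / (t - a))).
  have -> : (fun s : R => (s - a) ^+ m) = (fun s : R => s - a) ^+ m.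
    by apply/funext => s /=; rewrite exprfctE.
  apply: is_derive_eq; rewrite -[LHS]/(_ * 1) mulr1.
  case: m => [|m]; first by rewrite !mul0r mulr0.
  by rewrite exprS /=; field.
case: e => k; first exact: dX.
have -> : (fun s : R => (s - a) ^ Negz k) = (fun s : R => ((s - a) ^+ k.+1)^-1).
  by apply/funext.
have dXk := dX k.+1.
have nz : (t - a) ^+ k.+1 != 0 by rewrite expf_neq0.
have d2 := @is_deriveV R (fun s => (s - a) ^+ k.+1) t _ 1 nz dXk; apply: is_derive_eq.
rewrite -[LHS]/(_ * _) NegzE -exprnN rmorphN /= -pmulrn.
by field; rewrite ta0 expf_neq0.
Qed.

Lemma is_derive_rprod K t : (forall k, k \in K -> t != c k) ->
  is_derive t 1 (rprod K) (rprod K t * \sum_(k in K) (lam k)%:~R / (t - c k)).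
Proof.
move=> tK; rewrite /rprod -!big_enum /=.
have -> : (fun t : R => \prod_(k in K) (t - c k) ^ lam k) =
    (fun t : R => \prod_(k <- enum K) (t - c k) ^ lam k).
  by apply/funext => s; rewrite big_enum.
have : all (fun k => t != c k) (enum K).
  by apply/allP => k; rewrite mem_enum => /tK.
elim: (enum K) => [_|k s IH /= /andP[tk ts]].
  rewrite !big_nil mulr0.
  have -> : (fun t : R => \prod_(k <- [::]) (t - c k) ^ lam k) = cst 1.
    by apply/funext => s; rewrite big_nil.
  exact: is_derive_cst.
have d1 := is_derive_exprz (lam k) tk; have d2 := IH ts.
have -> : (fun t : R => \prod_(k <- k :: s) (t - c k) ^ lam k) =
   (fun t => (t - c k) ^ lam k) * (fun t => \prod_(k <- s) (t - c k) ^ lam k).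
  by apply/funext => x; rewrite big_cons.
apply: is_derive_eq; rewrite !big_cons -![_ *: _]/(_ * _) /=.
ring.
Qed.

Lemma horner_lognum K t : (forall k, k \in K -> t != c k) ->
  (lognum K).[t] =
  (\prod_(k in K) (t - c k)) * \sum_(k in K) (lam k)%:~R / (t - c k).
Proof.
move=> tK; rewrite horner_sum mulr_sumr; apply: eq_bigr => k kK.
rewrite hornerZ horner_prod (big_setD1 k kK) /=.
under eq_bigr do rewrite hornerXsubC.
have : t - c k != 0 by rewrite subr_eq0 tK.
by move=> ?; field.
Qed.

Lemma size_lognum K : (size (lognum K) <= #|K|)%N.
Proof.
apply: (leq_trans (size_sum _ _ _)); apply/bigmax_leqP => k kK.
apply: (leq_trans (size_scale_leq _ _)).
by rewrite -big_enum size_prod_XsubC -cardE (cardsD1 k K) kK.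
Qed.

(** The interval avoids all zeros and poles c_k, so the mean value theorem applies; its derivative
    is written through [lognum], so that equal values at the ends yield a root of [lognum]. *)
Lemma rprod_MVT K a b : a < b -> (forall k, k \in K -> ~~ (a <= c k <= b)) ->
  exists2 r, a < r < b & rprod K b - rprod K a =
    rprod K r * ((lognum K).[r] / \prod_(k in K) (r - c k)) * (b - a).
Proof.
move=> ab Kab.
have cK x : a <= x <= b -> forall k, k \in K -> x != c k.
  by move=> xab k /Kab; apply: contra => /eqP <-.
have [||r] := @MVT R (rprod K)
    (fun r => rprod K r * \sum_(k in K) (lam k)%:~R / (r - c k)) a b ab.
- move=> x; rewrite in_itv /= => /andP[ax xb].
  by apply/is_derive_rprod/cK; rewrite !ltW.
- apply: derivable_within_continuous => x; rewrite in_itv /= => xab.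
  by have [] := is_derive_rprod (cK x xab).
rewrite in_itv /= => rab ->; exists r => //.
have rK : forall k, k \in K -> r != c k.
  by apply: cK; case/andP: rab => /ltW -> /ltW ->.
congr (_ * _ * _); rewrite (horner_lognum rK) mulrC mulKf //.
by apply/prodf_neq0 => k /rK; rewrite subr_eq0.
Qed.

Lemma rprod_neq0 K t : (forall k, k \in K -> t != c k) -> rprod K t != 0.
Proof.
by move=> tK; apply/prodf_neq0 => k /tK; rewrite -subr_eq0; exact: expfz_neq0.
Qed.

Section Level.
Variables (C : R) (K : {set I}) (ss : seq R).
Hypothesis ss_sorted : sorted <%R ss.
Hypothesis ss_c : forall t k, t \in ss -> k \in K -> t != c k.
Hypothesis ss_level : forall t, t \in ss -> C * rprod K t = 1.
Hypothesis K_neq0 : lognum K != 0.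

(** [J] indexes the factors t - c_k kept beside [lognum K]. Two solutions either enclose such a c_k,
    or by hypothesis enclose no c_k at all and Rolle's argument gives a root of [lognum K]. The
    degree is at most #|K| - 1 + #|J|. *)
Lemma leq_size_level J :
  (forall a b, a \in ss -> b \in ss -> a < b ->
     (forall k, k \in J -> ~~ (a < c k < b)) ->
     forall k, k \in K -> ~~ (a < c k < b)) ->
  (size ss <= #|K| + #|J|)%N.
Proof.
move=> JK; pose p := lognum K * \prod_(k in J) ('X - (c k)%:P).
have pJ0 : \prod_(k in J) ('X - (c k)%:P) != 0.
  by apply/prodf_neq0 => k _; rewrite polyXsubC_eq0.
apply: (@leq_trans (size p)); last first.
  rewrite size_mul // -big_enum size_prod_XsubC -cardE addnS /=.
  by rewrite leq_add2r size_lognum.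
apply: leq_size_roots_between => // [|a b ass bss ab].
  by rewrite mulf_neq0.
have [/existsP[k /andP[kJ cab]]|/existsPn noJ] :=
    boolP [exists k, (k \in J) && (a < c k < b)].
  exists (c k) => //; rewrite rootM; apply/orP; right.
  by rewrite /root horner_prod (bigD1 k) //= hornerXsubC subrr mul0r.
have noK := JK a b ass bss ab
  (fun k kJ => contraNN (fun cab => introT andP (conj kJ cab)) (noJ k)).
have [k kK|r rab] := @rprod_MVT K a b ab.
  apply: contra (noK k kK) => /andP[ac cb].
  by rewrite !lt_neqAle ac cb (ss_c ass kK) eq_sym (ss_c bss kK).
have C0 : C != 0.
  by apply/eqP => C0; move: (ss_level ass); rewrite C0 mul0r => /eqP;
    rewrite eq_sym oner_eq0.
have -> : rprod K b = rprod K a.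
  by apply: (mulfI C0); rewrite !ss_level.
rewrite subrr => /esym/eqP; rewrite !mulf_eq0 subr_eq0 (gt_eqF ab) orbF.
have rK k : k \in K -> r != c k.
  by move=> kK; apply: contra (noK k kK) => /eqP <-.
rewrite (negPf (rprod_neq0 rK)) invr_eq0 /= => /orP[r0|]; last first.
  by case/idPn; apply/prodf_neq0 => k /rK; rewrite subr_eq0.
by exists r; rewrite // rootM /root r0.
Qed.

Lemma leq_size_level_double : (size ss <= #|K| + #|K|)%N.
Proof. by apply: leq_size_level => a b _ _ _. Qed.

Lemma leq_size_level_odd l : l \in K -> odd `|lam l|%N ->
  (size ss < #|K| + #|K|)%N.
Proof.
move=> lK odd_l; rewrite {2}(cardsD1 l K) lK addnCA add1n ltnS.
apply: leq_size_level => a b ass bss ab noK k kK.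
have [->{k kK}|kl] := eqVneq k l; last by apply: noK; rewrite !inE kl.
apply/negP => /andP[acl clb].
(* The product of the two level values is 1. Paired factor by factor it is C^2 times ((a - c_l)(b -
   c_l))^lam_l, negative if c_l lies between, times factors that are nonnegative because no other
   c_j lies between. *)
have : (C * rprod K a) * (C * rprod K b) = 1 by rewrite !ss_level // mulr1.
rewrite mulrACA -expr2 /rprod -big_split /= (big_setD1 l lK) /= => E.
have : 0 < 1 :> R by [].
rewrite -E ltNge pmulr_rle0; last first.
  rewrite exprn_even_gt0 //=; apply/eqP => C0; move: E.
  by rewrite C0 expr0n mul0r => /eqP; rewrite eq_sym oner_eq0.
rewrite nmulr_rle0 ?prodr_ge0 // => [j jK|]; last first.
  rewrite -expfzMl; apply: exprz_odd_lt0 => //.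
  by rewrite nmulr_rlt0 ?subr_lt0 ?subr_gt0.
have [aj bj] : a != c j /\ b != c j.
  by move: jK; rewrite !inE => /andP[_ jK]; rewrite !ss_c.
rewrite -expfzMl; apply: exprz_ge0; rewrite ltW //.
have := noK j jK; rewrite negb_and -!leNgt => /orP[cja|bcj].
  have cja' : c j < a by rewrite lt_neqAle eq_sym aj.
  by rewrite mulr_gt0 ?subr_gt0 // (lt_trans cja').
have bcj' : b < c j by rewrite lt_neqAle bj.
by rewrite nmulr_rgt0 ?subr_lt0 // (lt_trans ab).
Qed.
End Level.

(** A zero [lognum] makes the product locally constant, which later yields infinitely many
    solutions; [d] is bounded by the distance from [t0] to the nearest c_k. *)
Lemma lognum0_const K t0 : (forall k, k \in K -> t0 != c k) ->
  lognum K = 0 ->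
  exists2 d, 0 < d & forall t, 0 < t < d ->
    (forall k, k \in K -> t0 + t != c k) /\ rprod K (t0 + t) = rprod K t0.
Proof.
move=> t0K K0.
have [d d0 Kd] : exists2 d, 0 < d & forall k, k \in K -> d <= `|c k - t0|.
  exists (\big[Num.min/1]_(k in K) `|c k - t0|) => [|k kK]; last first.
    exact: bigmin_le_cond.
  by apply/bigmin_gtP; split=> // k /t0K; rewrite normr_gt0 subr_eq0 eq_sym.
exists d => // t /andP[t_gt0 td].
have noK k : k \in K -> ~~ (t0 <= c k <= t0 + t).
  move=> kK; apply/negP => /andP[cl cu]; have := Kd k kK.
  by rewrite ger0_norm ?subr_ge0 // leNgt ltrBlDl (le_lt_trans cu) // ltrD2l.
split=> [k /noK|]; first by apply: contra => /eqP <-; rewrite lexx lerDl ltW.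
have [|r _] := @rprod_MVT K t0 (t0 + t) _ noK; first by rewrite ltrDl.
by rewrite K0 horner0 mul0r mulr0 mul0r => /eqP; rewrite subr_eq0 => /eqP.
Qed.

End RationalProducts.

(** * Affine relations and the torus *)

Section AffineRelations.
Variables (n m : nat) (a : 'I_m -> 'rV[int]_n).

(** Row [d j] is the difference of affine coordinates of e_j and of 0. Its entries are the exponents
    that recover x_j from the monomials x^(a_k - b). *)
Lemma affine_coordinates :
  (forall x, exists2 c : 'I_m -> int,
     \sum_k c k = 1 & x = \sum_k c k *: a k) ->
  exists d : 'M[int]_(n, m), (forall j, \sum_k d j k = 0) /\
    (forall j, \sum_k d j k *: a k = delta_mx 0 j).
Proof.
move=> span; have [c0 s0 e0] := span 0.
have /fin_all_exists[d dP] : forall j : 'I_n, exists d : 'I_m -> int,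
    \sum_k d k = 0 /\ \sum_k d k *: a k = delta_mx 0 j.
  move=> j; have [c s e] := span (delta_mx 0 j).
  exists (fun k => c k - c0 k); rewrite sumrB s s0 subrr; split=> //.
  under eq_bigr do rewrite scalerBl.
  by rewrite sumrB -e -e0 subr0.
exists (\matrix_(j, k) d j k).
by split=> j; have [s e] := dP j; [rewrite -[RHS]s|rewrite -e];
  apply: eq_bigr => k _; rewrite mxE.
Qed.
End AffineRelations.

Section CircuitRelation.
Variables (n : nat) (a : 'I_n.+2 -> 'rV[int]_n).
Hypothesis span : forall x, exists2 c : 'I_n.+2 -> int,
  \sum_k c k = 1 & x = \sum_k c k *: a k.

(* The last row of the left unimodular factor of the Smith normal form of the
   matrix with rows (1, a k) generates the lattice of affine relations. *)
Lemma circuit_relation : exists lam : 'I_n.+2 -> int,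
  [/\ \sum_k lam k = 0, \sum_k lam k *: a k = 0,
      exists l, odd `|lam l|%N
    & forall (K : numDomainType) (rho : 'I_n.+2 -> K),
        \sum_k rho k = 0 -> \sum_k rho k *: map_mx intr (a k) = 0 ->
        exists p, forall k, rho k = p * (lam k)%:~R].
Proof.
pose M : 'M[int]_(n.+2, 1 + n) := row_mx (const_mx 1) (\matrix_k a k).
have [d [d0 d1]] := affine_coordinates span.
have [c c1 ca] := span 0.
pose B : 'M[int]_(1 + n, n.+2) := col_mx (\row_k c k) d.
have BM : B *m M = 1%:M.
  rewrite /B /M mul_col_row -[RHS]submxK scalar_mx_block block_mxKul
    block_mxKur block_mxKdl block_mxKdr; congr block_mx.
  - apply/rowP => i; rewrite !ord1 !mxE eqxx -[RHS]c1.
    by under eq_bigr => k _ do rewrite !mxE mulr1.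
  - rewrite mulmx_sum_row -[RHS]/0 [RHS]ca; apply: eq_bigr => k _.
    by rewrite mxE rowK.
  - apply/colP => j; rewrite !mxE -[RHS](d0 j).
    by apply: eq_bigr => k _; rewrite !mxE mulr1.
  - apply/row_matrixP => j; rewrite row_mul mulmx_sum_row row1 -(d1 j).
    by apply: eq_bigr => k _; rewrite mxE rowK.
have [L Lu [Q Qu [s _ ME]]] := int_Smith_normal_form M.
set D := (\matrix_(i, j) _) in ME.
have mulD (K : pzRingType) p (X : 'M[K]_(p, n.+2)) i (j : 'I_n.+1) :
    (X *m map_mx intr D) i j = X i (widen_ord (leqnSn _) j) * (s`_j)%:~R.
  rewrite mxE (bigD1 (widen_ord (leqnSn _) j)) //= big1 ?addr0.
    by rewrite !mxE eqxx mulr1n.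
  move=> k kj; rewrite !mxE; have -> : (k == j :> nat) = false.
    by apply: contraNF kj => /eqP kj; apply/eqP/val_inj.
  by rewrite mulr0n mulr0.
(* The left inverse [B] of [M] yields a left inverse of the Smith form, so no invariant factor
   vanishes. *)
have s_neq0 (j : 'I_n.+1) : s`_j != 0.
  have : (Q *m B *m L) *m D = 1%:M.
    have <- : Q *m (B *m M) *m invmx Q = 1%:M by rewrite BM mulmx1 mulmxV.
    by rewrite ME !mulmxA mulmxK.
  move=> /matrixP/(_ j j); rewrite [RHS]mxE eqxx => E.
  apply: contra_eqN E => /eqP sj0.
  have -> : D = map_mx intr D by apply/matrixP => ? ?; rewrite [RHS]mxE intz.
  by rewrite mulD sj0 mulr0.
pose lam k := invmx L ord_max k.
have lamM : row ord_max (invmx L) *m M = 0.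
  rewrite ME -!mulmxA -row_mul mulKmx // row_mul.
  have -> : row ord_max D = 0.
    by apply/rowP => j; rewrite !mxE gtn_eqF ?mulr0n.
  by rewrite mul0mx.
have lamQ : lam = fun k => (row ord_max (invmx L)) 0 k by apply/funext => k; rewrite mxE.
exists lam; rewrite lamQ.
have /(congr1 lsubmx) := lamM; rewrite /M mul_mx_row row_mxKl => lam0.
have /(congr1 rsubmx) := lamM; rewrite /M mul_mx_row row_mxKr => lam1.
split.
- move/rowP/(_ 0): lam0; rewrite !mxE => lam0; rewrite -[RHS]lam0.
  by apply: eq_bigr => k _; rewrite !mxE mulr1.
- move: lam1; rewrite mulmx_sum_row linear0 => lam1; rewrite -[RHS]lam1.
  by apply: eq_bigr => k _; rewrite rowK.
(* The last diagonal entry of [invmx L *m L] is 1 and is an integer combination of the lam_k. *)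
- apply: contrapT => /forallNP even_lam.
  have := congr1 (fun A : 'M[int]_n.+2 => A ord_max ord_max) (mulVmx Lu).
  rewrite /= [LHS]mxE [RHS]mxE eqxx => E; suff : (2 %| 1%:Z)%Z by [].
  rewrite -[X in (_ %| X)%Z]E; apply: (big_ind (fun x : int => (2 %| x)%Z)) => //.
    by move=> x y; exact: rpredD.
  move=> k _; apply: dvdz_mulr; rewrite dvdzE dvdn2.
  by apply/negP; have := even_lam k; rewrite mxE.
- move=> K rho rho0 rho1; pose r : 'rV[K]_n.+2 := \row_k rho k.
  have rM : r *m map_mx intr M = 0.
    rewrite /M map_row_mx mul_mx_row -[RHS]row_mx0; congr row_mx.
      apply/rowP => i; rewrite !mxE -[RHS]rho0; apply: eq_bigr => k _.
      by rewrite !mxE mulr1.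
    rewrite mulmx_sum_row -[RHS]rho1; apply: eq_bigr => k _; rewrite mxE.
    by congr (_ *: _); apply/rowP => j; rewrite !mxE.
  have rLD : (r *m map_mx intr L) *m map_mx intr D = 0.
    have QK : map_mx intr Q *m map_mx intr (invmx Q) = 1%:M :> 'M[K]_(1 + n).
      by rewrite -map_mxM mulmxV // map_mx1.
    rewrite -[LHS]mulmx1 -QK mulmxA -(mulmxA r) -map_mxM -(mulmxA r) -map_mxM.
    by rewrite -ME rM mul0mx.
  (* The nonzero invariant factors kill every coordinate of [r *m L] but the last, which becomes the
     multiplier [p]. *)
  have rL0 (j : 'I_n.+1) : (r *m map_mx intr L) 0 (widen_ord (leqnSn _) j) = 0.
    have := congr1 (fun A : 'rV[K]_n.+1 => A 0 j) rLD.
    rewrite /= mulD [RHS]mxE => /eqP; rewrite mulf_eq0 intr_eq0.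
    by rewrite (negPf (s_neq0 j)) orbF => /eqP.
  exists ((r *m map_mx intr L) 0 ord_max) => k.
  have -> : rho k = ((r *m map_mx intr L) *m map_mx intr (invmx L)) 0 k.
    by rewrite -mulmxA -map_mxM mulmxV // map_mx1 mulmx1 mxE.
  rewrite mxE big_ord_recr /= big1 ?add0r => [|j _]; last first.
    by rewrite -[widen_ord _ j]/(widen_ord (leqnSn _) j) rL0 mul0r.
  by congr (_ * _); rewrite !mxE.
Qed.
End CircuitRelation.

Section Monomials.
Variable K : fieldType.

Definition monom n (x : 'rV[K]_n) (b : 'rV[int]_n) : K :=
  \prod_(j < n) x 0 j ^ b 0 j.

Lemma monom_neq0 n (x : 'rV[K]_n) b : (forall j, x 0 j != 0) -> monom x b != 0.
Proof. by move=> x0; apply/prodf_neq0 => j _; exact: expfz_neq0. Qed.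

Section Torus.
Variables (n : nat) (x : 'rV[K]_n).
Hypothesis x_neq0 : forall j, x 0 j != 0.

Lemma monomD b c : monom x (b + c) = monom x b * monom x c.
Proof.
by rewrite -big_split; apply: eq_bigr => j _; rewrite mxE expfzDr.
Qed.

Lemma monom0 : monom x 0 = 1.
Proof. by rewrite /monom big1 // => j _; rewrite mxE expr0z. Qed.

Lemma monomZ (k : int) b : monom x (k *: b) = monom x b ^ k.
Proof.
rewrite /monom (big_morph (fun y => y ^ k) (fun y z => expfzMl y z k) (exp1rz _ k)).
by apply: eq_bigr => j _; rewrite mxE mulrC exprz_exp.
Qed.

Lemma monom_sum (I : finType) (b : I -> 'rV[int]_n) :
  monom x (\sum_i b i) = \prod_i monom x (b i).
Proof. by apply: big_morph; [exact: monomD|exact: monom0]. Qed.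

End Torus.

Lemma monom_eq1 n (x : 'rV[K]_n) m (a : 'I_m -> 'rV[int]_n) (lam : 'I_m -> int) b :
  (forall j, x 0 j != 0) -> \sum_k lam k = 0 -> \sum_k lam k *: a k = 0 ->
  \prod_k monom x (a k - b) ^ lam k = 1.
Proof.
move=> x0 lam0 lam1; under eq_bigr do rewrite -monomZ // scalerBr.
by rewrite -monom_sum // sumrB lam1 -scaler_suml lam0 scale0r subr0 monom0.
Qed.

Lemma torus_inj n m (a : 'I_m -> 'rV[int]_n) (d : 'M[int]_(n, m)) b
    (x y : 'rV[K]_n) :
  (forall j, \sum_k d j k = 0) ->
  (forall j, \sum_k d j k *: a k = delta_mx 0 j) ->
  (forall j, x 0 j != 0) -> (forall j, y 0 j != 0) ->
  (forall k, monom x (a k - b) = monom y (a k - b)) -> x = y.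
Proof.
move=> d0 d1 x0 y0 xy.
have coord (z : 'rV[K]_n) : (forall j, z 0 j != 0) ->
    forall j, z 0 j = \prod_k monom z (a k - b) ^ d j k.
  move=> z0 j; under eq_bigr do rewrite -monomZ // scalerBr.
  rewrite -monom_sum // sumrB d1 -scaler_suml d0 scale0r subr0.
  rewrite /monom (bigD1 j) //= mxE !eqxx expr1z big1 ?mulr1 // => i ij.
  by rewrite mxE (negPf ij) andbF expr0z.
by apply/rowP => j; rewrite !coord //; apply: eq_bigr => k _; rewrite xy.
Qed.

(** Take x_j to be the monomial in z with exponents [d j]. The exponents of x^(a_l - a_i) in z
    differ from those of z_l / z_i by an affine relation, hence by a multiple of [lam], and z^lam is
    1. *)
Lemma torus_lift n m (a : 'I_m -> 'rV[int]_n) (d : 'M[int]_(n, m))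
    (lam : 'I_m -> int) (z : 'I_m -> K) i :
  (forall j, \sum_k d j k = 0) ->
  (forall j, \sum_k d j k *: a k = delta_mx 0 j) ->
  (forall rho : 'I_m -> int, \sum_k rho k = 0 -> \sum_k rho k *: a k = 0 ->
     exists p, forall k, rho k = p * lam k) ->
  (forall k, z k != 0) -> \prod_k z k ^ lam k = 1 ->
  exists x : 'rV[K]_n, (forall j, x 0 j != 0) /\
    (forall l, monom x (a l - a i) = z l / z i).
Proof.
move=> d0 d1 relE z0 zlam.
exists (\row_j \prod_k z k ^ d j k); split=> [j|l].
  by rewrite mxE; apply/prodf_neq0 => k _; exact: expfz_neq0.
rewrite /monom; pose b := a l - a i.
pose e k : int := \sum_j d j k * b 0 j.
have -> : \prod_(j < n) (\row_j \prod_k z k ^ d j k) 0 j ^ b 0 j =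
    \prod_k z k ^ e k.
  transitivity (\prod_(j < n) \prod_k z k ^ (d j k * b 0 j)).
    apply: eq_bigr => j _; rewrite mxE.
    rewrite (big_morph (fun y => y ^ b 0 j) (fun y z => expfzMl y z _)
      (exp1rz _ _)).
    by apply: eq_bigr => k _; rewrite exprz_exp.
  rewrite exchange_big; apply: eq_bigr => k _ /=.
  rewrite /e; elim/big_ind2 : _ => [|x u y v -> ->|//]; first by rewrite expr0z.
  by rewrite expfzDr.
pose del (l k : 'I_m) : int := (k == l)%:R.
have del1 l' : \sum_k del l' k = 1.
  by rewrite (bigD1 l') //= /del eqxx big1 ?addr0 // => k /negPf ->.
have dela l' : \sum_k del l' k *: a k = a l'.
  rewrite (bigD1 l') //= /del eqxx scale1r big1 ?addr0 // => k /negPf ->.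
  by rewrite scale0r.
have delz l' : \prod_k z k ^ del l' k = z l'.
  by rewrite (bigD1 l') //= /del eqxx big1 ?mulr1 // => k /negPf ->.
have [||p pE] := relE (fun k => e k - (del l k - del i k)).
- rewrite !sumrB !del1 subrr subr0 exchange_big /= big1 // => j _.
  by rewrite -mulr_suml d0 mul0r.
- under eq_bigr do rewrite !scalerBl.
  rewrite !sumrB !dela; apply/eqP; rewrite subr_eq0; apply/eqP.
  transitivity (\sum_j b 0 j *: (\sum_k d j k *: a k)).
    under eq_bigr do rewrite scaler_suml.
    rewrite exchange_big; apply: eq_bigr => j _ /=.
    by rewrite scaler_sumr; apply: eq_bigr => k _; rewrite scalerA mulrC.
  by under eq_bigr do rewrite d1; rewrite -row_sum_delta.
transitivity (\prod_k ((z k ^ lam k) ^ p * (z k ^ del l k / z k ^ del i k))).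
  apply: eq_bigr => k _; rewrite exprz_exp mulrC invr_expz -!expfzDr //.
  by rewrite (mulrC (lam k)) -pE; congr (_ ^ _); ring.
rewrite big_split /= prodf_div !delz.
by rewrite -(big_morph (fun y => y ^ p) (fun y z => expfzMl y z _) (exp1rz _ _))
  zlam exp1rz mul1r.
Qed.
End Monomials.

(** * Deforming complex solutions *)

Section ComplexPerturbation.
Variable R : realType.
Let normc := @ComplexField.Normc.normc R.
Implicit Types (p q : {poly R[i]}).
Local Open Scope complex_scope.

Lemma normc_real (x : R) : normc x%:C = `|x|.
Proof. by rewrite /normc /= expr0n addr0 sqrtr_sqr. Qed.

Lemma normc_ge0 x : 0 <= normc x.
Proof. by case: x => a b; exact: sqrtr_ge0. Qed.

Lemma normc_eq0 x : (normc x == 0) = (x == 0).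
Proof.
apply/eqP/eqP => [|->]; first exact: ComplexField.Normc.eq0_normc.
exact: ComplexField.Normc.normc0.
Qed.

Lemma normcM (x y : R[i]) : normc (x * y) = normc x * normc y.
Proof. exact: ComplexField.Normc.normcM. Qed.

Lemma normcD (x y : R[i]) : normc (x + y) <= normc x + normc y.
Proof. exact: le_normcD. Qed.

Lemma normcN (x : R[i]) : normc (- x) = normc x.
Proof. by case: x => a b; rewrite /normc /= !sqrrN. Qed.

Lemma normc_sub_ge (x y : R[i]) : normc x - normc y <= normc (x - y).
Proof. by rewrite lerBlDr -{1}(subrK y x) normcD. Qed.

Lemma normc_prod (r : seq R[i]) (f : R[i] -> R[i]) :
  normc (\prod_(z <- r) f z) = \prod_(z <- r) normc (f z).
Proof. by apply: big_morph; [exact: normcM|exact: ComplexField.Normc.normc1]. Qed.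

(* |1 - t / r| <= 1 + |t| / rho for every root r of p. *)
Lemma normc_horner_far_roots p (t : R[i]) (rho : R) : 0 < rho ->
  (forall r, root p r -> rho <= normc r) ->
  normc p.[t] <= normc p.[0] * (1 + normc t / rho) ^+ (size p).-1.
Proof.
move=> rho0 far; have [r pE] := closed_field_poly_normal p.
have [->|p0] := eqVneq p 0; first by rewrite !horner0 [normc 0]ComplexField.Normc.normc0 mul0r.
have lc0 : lead_coef p != 0 by rewrite lead_coef_eq0.
have pX z : p.[z] = lead_coef p * \prod_(x <- r) (z - x).
  rewrite {1}pE hornerZ horner_prod; congr (_ * _).
  by apply: eq_bigr => x _; rewrite hornerXsubC.
have <- : size r = (size p).-1 by rewrite pE size_scale // size_prod_XsubC.
have far' : all (fun x => rho <= normc x) r.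
  by apply/allP => x xr; apply: far; rewrite pE rootZ // root_prod_XsubC.
rewrite !pX !normcM -mulrA ler_wpM2l ?normc_ge0 // !normc_prod.
elim: r far' {pE pX} => [|x r IH /= /andP[rx far_r]].
  by rewrite !big_nil expr0 mulr1.
rewrite !big_cons exprS mulrACA ler_pM ?normc_ge0 ?IH //.
  by rewrite prodr_ge0 // => ? _; exact: normc_ge0.
apply: (le_trans (normcD _ _)).
rewrite sub0r !normcN addrC mulrDr mulr1.
rewrite lerD2l mulrCA ler_peMr ?normc_ge0 // ler_pdivlMr ?mul1r //.
Qed.

Lemma horner_near0 q : exists2 B, 0 <= B &
  forall s : R, 0 <= s <= 1 -> normc (q.[s%:C] - q.[0]) <= B * s.
Proof.
elim/poly_ind: q => [|q c [B B0 qB]].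
  exists 0 => // s _; rewrite !horner0 subrr mul0r.
  by rewrite -[0]/(0%:C) normc_real normr0.
exists (normc q.[0] + B) => [|s /andP[s0 s1]]; first by rewrite addr_ge0 ?normc_ge0.
rewrite !hornerMXaddC mulr0 add0r addrK normcM normc_real ger0_norm //.
rewrite ler_wpM2r // -{1}(subrK q.[0] q.[s%:C]) (le_trans (normcD _ _)) //.
rewrite addrC lerD2l (le_trans (qB s _)) ?s0 //.
by rewrite ler_piMr.
Qed.

Section Lines.
Variables (I : finType) (lam : I -> int).
Implicit Types (y v u z : I -> R[i]).

(** Splitting [lam] into positive and negative parts clears denominators: on the torus, z^lam = 1
    becomes a binomial equation whose restriction to a line is a polynomial. *)
Definition pexp (k : I) : nat := if 0 <= lam k then `|lam k|%N else 0.
Definition nexp (k : I) : nat := if 0 <= lam k then 0 else `|lam k|%N.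

Definition binom_eq z := \prod_k z k ^+ pexp k - \prod_k z k ^+ nexp k.

Lemma binom_eq0 z : (forall k, z k != 0) ->
  (binom_eq z == 0) = (\prod_k z k ^ lam k == 1).
Proof.
move=> z0; rewrite /binom_eq subr_eq0.
have -> : \prod_k z k ^ lam k = (\prod_k z k ^+ pexp k) / \prod_k z k ^+ nexp k.
  rewrite -prodf_div; apply: eq_bigr => k _; rewrite /pexp /nexp.
  case: (lam k) => e; first by rewrite /= expr0 divr1.
  by rewrite NegzE /= -exprnN expr0 div1r.
rewrite -[RHS](inj_eq (mulIf (_ : \prod_k z k ^+ nexp k != 0))).
  rewrite divfK ?mul1r //.
all: by apply/prodf_neq0 => k _; rewrite expf_neq0.
Qed.

Definition binom_line y u : {poly R[i]} :=
  \prod_k ((y k)%:P + u k *: 'X) ^+ pexp k -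
  \prod_k ((y k)%:P + u k *: 'X) ^+ nexp k.

Lemma horner_binom_line y u t :
  (binom_line y u).[t] = binom_eq (fun k => y k + t * u k).
Proof.
rewrite /binom_line hornerD hornerN !horner_prod; congr (_ - _).
all: apply: eq_bigr => k _; rewrite horner_exp hornerD hornerC hornerZ hornerX.
all: by rewrite mulrC.
Qed.

(** A degree bound common to all lines makes the constant obtained from [normc_horner_far_roots]
    independent of the moving line. *)
Lemma size_binom_line : exists d, forall y u, ((size (binom_line y u)).-1 <= d)%N.
Proof.
have szprod (e : I -> nat) y u :
    (size (\prod_k ((y k)%:P + u k *: 'X) ^+ e k : {poly R[i]})%R
       <= (\sum_k e k).+1)%N.
  elim/big_ind2 : _ => [|p d q d' Hp Hq|k _]; first by rewrite size_poly1.
    apply: (leq_trans (size_mul_leq _ _)).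
    by rewrite -subn1 leq_subLR add1n -addnS -addSn leq_add.
  apply: (leq_trans (size_poly_exp_leq _ _)).
  rewrite ltnS -{2}(mul1n (e k)) leq_mul2r -subn1 leq_subLR; apply/orP; right.
  apply: (leq_trans (size_polyD _ _)); rewrite geq_max.
  rewrite (leq_trans (size_polyC_leq1 _)) //=.
  by rewrite (leq_trans (size_scale_leq _ _)) // size_polyX.
exists (maxn (\sum_k pexp k) (\sum_k nexp k)) => y u.
rewrite -subn1 leq_subLR add1n -maxnSS (leq_trans (size_polyD _ _)) //.
by rewrite size_polyN geq_max !leq_max !szprod orbT.
Qed.

(* The polynomial t |-> binom_eq (y + s v + t u) has a value at 0 tending to 0 and a
   value at some t1 tending to a nonzero limit as s tends to 0, so one of its
   roots tends to 0. *)
Lemma binom_eq_near y v u rho : 0 < rho -> binom_eq y = 0 ->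
  (exists t, binom_eq (fun k => y k + t * u k) != 0) ->
  exists2 d : R, 0 < d & forall s, 0 < s < d ->
    exists2 t, normc t < rho & binom_eq (fun k => y k + s%:C * v k + t * u k) = 0.
Proof.
move=> rho0 y0 [t1 yt1]; have [deg degP] := size_binom_line.
(* Let F(s, t) be the binomial at y + s v + t u. Then [pa] is F(s, t1) and [pb] is F(s, 0) as
   polynomials in s; below, [ps] is F(s, t) as a polynomial in t. *)
pose pa := binom_line (fun k => y k + t1 * u k) v; pose pb := binom_line y v.
have [Ba Ba0 paP] := horner_near0 pa; have [Bb Bb0 pbP] := horner_near0 pb.
have b0 : pb.[0] = 0.
  rewrite horner_binom_line -[RHS]y0; apply: congr1.
  by apply/funext => k; rewrite mul0r addr0.
have a0 : pa.[0] = binom_eq (fun k => y k + t1 * u k).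
  rewrite horner_binom_line; apply: congr1.
  by apply/funext => k; rewrite mul0r addr0.
set g := normc pa.[0]; have g0 : 0 < g by rewrite lt_neqAle normc_ge0 eq_sym normc_eq0 a0 yt1.
pose Q := (1 + normc t1 / rho) ^+ deg.
have Q1 : 1 <= 1 + normc t1 / rho by rewrite lerDl divr_ge0 ?normc_ge0 ?ltW.
have Q0 : 0 <= Q by rewrite exprn_ge0 // (le_trans ler01).
have den0 : 0 < Ba + Bb * Q + g + 1 by rewrite ltr_wpDl // !addr_ge0 ?mulr_ge0 // ltW.
(* Without a root of size below [rho] one would have g - Ba s <= Bb Q s, which fails for s below
   this value. The summand g + 1 also forces s <= 1, the range of [horner_near0]. *)
exists (g / (Ba + Bb * Q + g + 1)) => [|s /andP[s0]]; first by rewrite divr_gt0.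
rewrite ltr_pdivlMr // => sg.
have s1 : 0 <= s <= 1.
  rewrite ltW //= leNgt; apply/negP => s1.
  have : 1 * (Ba + Bb * Q + g + 1) <= s * (Ba + Bb * Q + g + 1).
    by rewrite ler_pM2r // ltW.
  have := mulr_ge0 Bb0 Q0; lra.
apply: contrapT => no_root.
pose ps := binom_line (fun k => y k + s%:C * v k) u.
have far_ps r : root ps r -> rho <= normc r.
  move=> /rootP; rewrite horner_binom_line => r0; rewrite leNgt; apply/negP => rr.
  by apply: no_root; exists r.
have := normc_horner_far_roots t1 rho0 far_ps.
have -> : ps.[t1] = pa.[s%:C].
  rewrite !horner_binom_line; apply: congr1; apply/funext => k.
  by rewrite addrAC.
have -> : ps.[0] = pb.[s%:C].
  rewrite !horner_binom_line; apply: congr1; apply/funext => k.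
  by rewrite mul0r addr0.
have := paP s s1; have := pbP s s1; rewrite b0 subr0 => bs as_.
have as' : g - Ba * s <= normc pa.[s%:C].
  have := normc_sub_ge pa.[0] (pa.[0] - pa.[s%:C]).
  have -> : pa.[0] - (pa.[0] - pa.[s%:C]) = pa.[s%:C] by ring.
  rewrite -/g -(opprB pa.[s%:C]) normcN.
  by move=> h; apply: le_trans h; rewrite lerD2l lerN2.
have Qle : (1 + normc t1 / rho) ^+ (size ps).-1 <= Q by apply: ler_weXn2l => //; exact: degP.
have Q'0 : 0 <= (1 + normc t1 / rho) ^+ (size ps).-1 by rewrite exprn_ge0 // (le_trans ler01).
have : normc pb.[s%:C] * (1 + normc t1 / rho) ^+ (size ps).-1 <= Bb * s * Q.
  by apply: ler_pM; rewrite ?normc_ge0.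
have := mulr_ge0 (ltW s0) (ltW g0).
move=> sg0 le2 le1; have := le_trans as' (le_trans le1 le2).
have -> : Bb * s * Q = s * (Bb * Q) by ring.
rewrite lerBlDl (mulrC Ba) => gle; move: sg; rewrite !mulrDr mulr1 => sg.
have := lt_le_trans sg gle.
by rewrite -addrA gtrDl ltNge addr_ge0 // ltW.
Qed.

Lemma nonvanishing_radius y v u : (forall k, y k != 0) ->
  exists2 rho : R, 0 < rho & forall s t, normc s < rho -> normc t < rho ->
    forall k, y k + s * v k + t * u k != 0.
Proof.
move=> y0; pose e k := normc (y k) / (normc (v k) + normc (u k) + 1).
have den0 k : 0 < normc (v k) + normc (u k) + 1.
  by rewrite ltr_wpDl // addr_ge0 ?normc_ge0.
exists (\big[Num.min/1]_k e k) => [|s t sr tr k].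
  apply/bigmin_gtP; split=> // k _.
  by rewrite divr_gt0 // lt_neqAle normc_ge0 eq_sym normc_eq0 y0.
apply/eqP => E.
have yE : y k = - (s * v k + t * u k) by apply/eqP; rewrite -subr_eq0 opprK addrA E.
have re : \big[Num.min/1]_k e k <= e k by exact: bigmin_le_cond.
have ek : normc (y k) = e k * (normc (v k) + normc (u k) + 1).
  by rewrite /e divfK // gt_eqF.
have e0 : 0 < e k by rewrite divr_gt0 // lt_neqAle normc_ge0 eq_sym normc_eq0 y0.
have : normc (y k) <= normc s * normc (v k) + normc t * normc (u k).
  by rewrite yE normcN (le_trans (normcD _ _)) // !normcM.
have sv : normc s * normc (v k) <= e k * normc (v k).
  by rewrite ler_wpM2r ?normc_ge0 // ltW // (lt_le_trans sr).
have tu : normc t * normc (u k) <= e k * normc (u k).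
  by rewrite ler_wpM2r ?normc_ge0 // ltW // (lt_le_trans tr).
rewrite ek !mulrDr mulr1; lra.
Qed.

(** If the binomial is not identically zero along u, each small step along v is corrected along u by
    [binom_eq_near]; otherwise the line in direction u itself lies in the zero set. The nonzero
    minor makes v and u independent, so distinct steps give distinct points. *)
Lemma binom_plane_infinite y v u : (forall k, y k != 0) ->
  \prod_k y k ^ lam k = 1 ->
  (exists k l, v k != 0 /\ v k * u l - v l * u k != 0) ->
  exists z : nat -> I -> R[i], [/\ injective z, forall i k, z i k != 0,
    forall i, \prod_k z i k ^ lam k = 1
    & forall i, exists s t, forall k, z i k = y k + s * v k + t * u k].
Proof.
move=> y0 y1 [k0 [l0 [vk0 minor]]].
have [rho rho0 nonvanishing] := nonvanishing_radius v u y0.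
have G0 : binom_eq y = 0 by apply/eqP; rewrite binom_eq0 // y1.
have step_pos (d : R) i : 0 < d -> 0 < d / i.+2%:R < d.
  by move=> d0; rewrite divr_gt0 //= ltr_pdivrMr // ltr_pMr // ltr1n.
have step_inj (d : R) : 0 < d -> injective (fun i : nat => d / i.+2%:R).
  move=> d0 i j /(mulfI (lt0r_neq0 d0)) /invr_inj /eqP.
  by rewrite eqr_nat => /eqP [].
have [h|] := pselect (exists t, binom_eq (fun k => y k + t * u k) != 0).
  have [d d0 dP] := binom_eq_near v rho0 G0 h.
  pose e := Num.min d rho.
  have e0 : 0 < e by rewrite lt_min d0.
  have /choice[t tP] : forall i : nat, exists t, normc t < rho /\
      binom_eq (fun k => y k + (e / i.+2%:R)%:C * v k + t * u k) = 0.
    move=> i; have /andP[s0 se] := step_pos e i e0.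
    have [|t ? ?] := dP (e / i.+2%:R); last by exists t.
    by rewrite s0 (lt_le_trans se) // ge_min lexx.
  pose z i k := y k + (e / i.+2%:R)%:C * v k + t i * u k.
  have z0 i k : z i k != 0.
    apply: nonvanishing; last by have [] := tP i.
    have /andP[s0 se] := step_pos e i e0.
    by rewrite normc_real gtr0_norm // (lt_le_trans se) // ge_min lexx orbT.
  exists z; split=> // [i j zij|i|i]; last by exists (e / i.+2%:R)%:C, (t i).
  - apply: (step_inj e e0) => /=; apply: complexI.
    have eqk k : ((e / i.+2%:R)%:C - (e / j.+2%:R)%:C) * v k + (t i - t j) * u k = 0.
      have E : z i k - z j k = 0 by rewrite zij subrr.
      by rewrite -[RHS]E /z; ring.
    have [ek el] := (eqk k0, eqk l0).
    have tt : (t i - t j) * (v k0 * u l0 - v l0 * u k0) = 0.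
      by rewrite -[LHS](_ : v k0 * 0 - v l0 * 0 = _); [ring|rewrite -{1}el -ek; ring].
    move/eqP: tt; rewrite mulf_eq0 (negPf minor) orbF => /eqP tt.
    move/eqP: ek; rewrite tt mul0r addr0 mulf_eq0 (negPf vk0) orbF subr_eq0.
    by move=> /eqP.
  - by apply/eqP; rewrite -binom_eq0 //; have [_ ->] := tP i.
move=> /forallNP G_const; pose z i k := y k + 0 * v k + (rho / i.+2%:R)%:C * u k.
have z0 i k : z i k != 0.
  apply: nonvanishing; first by rewrite -[0]/(0%:C) normc_real normr0.
  by have /andP[s0 sr] := step_pos rho i rho0; rewrite normc_real gtr0_norm.
exists z; split=> // [i j zij|i|i]; last by exists 0, (rho / i.+2%:R)%:C.
- apply: (step_inj rho rho0) => /=; apply: complexI.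
  have [l ul] : exists l, u l != 0.
    apply: contrapT => /forallNP ul; move/negP: minor; apply.
    have u0 k : u k = 0 by apply/eqP; have := ul k => /negP; rewrite negbK.
    by rewrite !u0 !mulr0 subrr.
  have := congr1 (fun f => f l) zij; rewrite /z => /addrI /(mulIf ul).
  exact.
- apply/eqP; rewrite -binom_eq0 //; have /negP := G_const (rho / i.+2%:R)%:C.
  rewrite negbK => /eqP E; apply/eqP; rewrite -[RHS]E; apply: congr1.
  by apply/funext => k; rewrite /z mul0r addr0.
Qed.
End Lines.
End ComplexPerturbation.

(** * Upper bounds *)

Section CircuitSystem.
Variables (R : realType) (n : nat) (a : 'I_n.+2 -> 'rV[int]_n).
Variables (M : 'I_n -> 'I_n.+2 -> R) (lam : 'I_n.+2 -> int).

Definition indexed_solution (K : fieldType) (iota : R -> K) (x : 'rV[K]_n) :=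
  (forall j, x 0 j != 0) /\
  (forall i, \sum_k iota (M i k) * monom x (a k) = 0).

Hypothesis span : forall x, exists2 c : 'I_n.+2 -> int,
  \sum_k c k = 1 & x = \sum_k c k *: a k.
Hypotheses (lam_sum : \sum_k lam k = 0) (lam_a : \sum_k lam k *: a k = 0).
Hypothesis lam_odd : exists l, odd `|lam l|%N.
Hypothesis lam_gen : forall rho : 'I_n.+2 -> int,
  \sum_k rho k = 0 -> \sum_k rho k *: a k = 0 ->
  exists p, forall k, rho k = p * lam k.
Variable N : nat.
Hypothesis complex_finite : forall xs : seq 'rV[R[i]]_n, uniq xs ->
  {in xs, forall x, indexed_solution (real_complex R) x} -> (size xs <= N)%N.

Lemma sum_monom_shift (K : fieldType) (x : 'rV[K]_n) (m : 'I_n.+2 -> K) b :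
  (forall j, x 0 j != 0) ->
  \sum_k m k * monom x (a k - b) = (\sum_k m k * monom x (a k)) * monom x (- b).
Proof.
move=> x0; rewrite mulr_suml; apply: eq_bigr => k _.
by rewrite monomD // mulrA.
Qed.

(** The lift sees only the quotients z_l / z_i0. Fixing the coordinate at i0 keeps the lifts
    distinct, and N + 1 of them contradict finiteness. *)
Lemma no_infinite_family (z : nat -> 'I_n.+2 -> R[i]) i0 c :
  injective z -> (forall i k, z i k != 0) -> (forall i, z i i0 = c) ->
  (forall i, \prod_k z i k ^ lam k = 1) ->
  (forall i j, \sum_k real_complex R (M j k) * z i k = 0) -> False.
Proof.
move=> z_inj z0 zc z1 zM; have [d [d0 d1]] := affine_coordinates span.
have /choice[x xP] : forall i, exists x : 'rV[R[i]]_n, (forall j, x 0 j != 0) /\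
    (forall l, monom x (a l - a i0) = z i l / z i i0).
  by move=> i; exact: torus_lift d0 d1 lam_gen (z0 i) (z1 i).
have c0 : c != 0 by rewrite -(zc 0).
have x_inj : injective x.
  move=> i j xij; apply: z_inj; apply/funext => k; apply: (mulIf (invr_neq0 c0)).
  have [[_ xi] [_ xj]] := (xP i, xP j).
  by rewrite -{1}(zc i) -(zc j) -xi -xj xij.
suff : (N < N)%N by rewrite ltnn.
rewrite -[X in (X <= _)%N](size_iota 0) -(size_map x).
apply: complex_finite; first by rewrite map_inj_uniq ?iota_uniq.
move=> _ /mapP[i _ ->]; have [x0 xi] := xP i; split=> // j.
have := sum_monom_shift (fun k => real_complex R (M j k)) (a i0) x0.
under eq_bigr do rewrite xi mulrA.
rewrite -mulr_suml zM mul0r => /esym/eqP; rewrite mulf_eq0.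
by rewrite (negPf (monom_neq0 _ x0)) orbF => /eqP.
Qed.

Lemma real_complex_prod (z : 'I_n.+2 -> R) :
  \prod_k (real_complex R (z k)) ^ lam k = real_complex R (\prod_k z k ^ lam k).
Proof.
rewrite rmorph_prod; apply: eq_bigr => k _.
by case: (lam k) => e; rewrite ?NegzE -?exprnN -?exprnP ?fmorphV rmorphXn.
Qed.

Section WithBasePoint.
Variables (i0 : 'I_n.+2).
Hypothesis i0_odd : odd `|lam i0|%N.

Let zvec (x : 'rV[R]_n) k := monom x (a k - a i0).
(** The last column fixes the coordinate at [i0]: the row kernel of [A] is the direction space of
    the solutions z of the linear system with z_i0 = 1. *)
Let A : 'M[R]_(n.+2, n + 1) :=
  row_mx (\matrix_(k, i) M i k) (\col_k (k == i0)%:R).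

Lemma sub_kermxA (w : 'rV[R]_n.+2) : (w <= kermx A)%MS ->
  w 0 i0 = 0 /\ forall i, \sum_k M i k * w 0 k = 0.
Proof.
move=> /sub_kermxP; rewrite mul_mx_row => /eqP; rewrite row_mx_eq0.
case/andP => /eqP/rowP wM /eqP/rowP/(_ 0).
rewrite !mxE (bigD1 i0) //= !mxE eqxx mulr1 big1 ?addr0 => [|k ki]; last first.
  by rewrite !mxE (negPf ki) mulr0.
split=> // i; have := wM i; rewrite !mxE => wMi; rewrite -[RHS]wMi.
by apply: eq_bigr => k _; rewrite !mxE mulrC.
Qed.

Lemma zvec_diff x y : indexed_solution idfun x -> indexed_solution idfun y ->
  (\row_k (zvec x k - zvec y k) <= kermx A)%MS.
Proof.
move=> [x0 xM] [y0 yM]; apply/sub_kermxP; rewrite mul_mx_row -[RHS]row_mx0.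
congr row_mx; apply/rowP => i; rewrite !mxE.
  have sM (z : 'rV[R]_n) : (forall j, z 0 j != 0) ->
      (forall i, \sum_k idfun (M i k) * monom z (a k) = 0) ->
      \sum_k M i k * zvec z k = 0.
    by move=> z0 zM; rewrite sum_monom_shift //= zM mul0r.
  transitivity (\sum_k M i k * zvec x k - \sum_k M i k * zvec y k).
    by rewrite -sumrB; apply: eq_bigr => k _; rewrite !mxE mulrC mulrBr.
  by rewrite !sM // subrr.
rewrite (bigD1 i0) //= big1 ?addr0 => [|k ki]; last first.
  by rewrite !mxE (negPf ki) mulr0.
by rewrite !mxE /zvec subrr !monom0 // subrr mul0r.
Qed.

Let zvec_neq0 x k : indexed_solution idfun x -> zvec x k != 0.
Proof. by case=> x0 _; exact: monom_neq0. Qed.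

Let zvec_prod x : indexed_solution idfun x -> \prod_k zvec x k ^ lam k = 1.
Proof. by case=> x0 _; exact: monom_eq1. Qed.

Let zvec_M x i : indexed_solution idfun x -> \sum_k M i k * zvec x k = 0.
Proof. by move=> [x0 xM]; rewrite sum_monom_shift //= xM mul0r. Qed.

Let zvec_i0 x : zvec x i0 = 1.
Proof. by rewrite /zvec subrr monom0. Qed.

(** Two independent directions, complexified, would span a plane through a real solution, and
    [binom_plane_infinite] would find infinitely many complex solutions on it. *)
Lemma ker_rank_le1 x : indexed_solution idfun x -> (\rank (kermx A) <= 1)%N.
Proof.
move=> xsol; rewrite leqNgt; apply/negP => rk.
have W0 : kermx A != 0 by rewrite -mxrank_eq0; case: (\rank _) rk.
set v := nz_row (kermx A).
have v0 : v != 0 by rewrite nz_row_eq0.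
have vW : (v <= kermx A)%MS by exact: nz_row_sub.
have /row_subPn[l uNv] : ~~ (kermx A <= v)%MS.
  apply/negP => /mxrankS; rewrite rank_rV v0 => le1.
  by move: rk; rewrite ltnNge le1.
set u := row l (kermx A) in uNv; have uW : (u <= kermx A)%MS by exact: row_sub.
have [k0 vk0] : exists k, v 0 k != 0.
  apply: contrapT => /forallNP vN; move/eqP: v0; apply.
  by apply/rowP => k; rewrite [RHS]mxE; have /negP := vN k; rewrite negbK => /eqP.
have [l0 ul0] : exists l, v 0 k0 * u 0 l - v 0 l * u 0 k0 != 0.
  apply: contrapT => /forallNP uN; move/negP: uNv; apply.
  apply/sub_rVP; exists (u 0 k0 / v 0 k0); apply/rowP => k; rewrite [RHS]mxE.
  have /negP := uN k; rewrite negbK subr_eq0 => /eqP E.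
  by apply: (mulfI vk0); rewrite E; field.
pose C := real_complex R.
have [| | |z [z_inj z0 z1 zP]] := @binom_plane_infinite R _ lam
    (fun k => C (zvec x k)) (fun k => C (v 0 k)) (fun k => C (u 0 k)).
- by move=> k; rewrite fmorph_eq0 zvec_neq0.
- by rewrite real_complex_prod zvec_prod // rmorph1.
- exists k0, l0; split; first by rewrite fmorph_eq0.
  by rewrite -!rmorphM -rmorphB fmorph_eq0.
have [[v_i0 vM] [u_i0 uM]] := (sub_kermxA vW, sub_kermxA uW).
apply: (@no_infinite_family z i0 1) => // [i|i j]; have [s [t zE]] := zP i.
  by rewrite zE v_i0 u_i0 zvec_i0 /C rmorph0 rmorph1 !mulr0 !addr0.
transitivity (C (\sum_k M j k * zvec x k) + s * C (\sum_k M j k * v 0 k) +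
    t * C (\sum_k M j k * u 0 k)).
  rewrite /C !rmorph_sum !mulr_sumr -!big_split; apply: eq_bigr => k _ /=.
  by rewrite zE /C !rmorphM /=; ring.
by rewrite zvec_M // vM uM /C rmorph0 !mulr0 !addr0.
Qed.
Lemma ker_direction x0 : indexed_solution idfun x0 ->
  exists v : 'I_n.+2 -> R, [/\ v i0 = 0, exists k, v k != 0,
    forall i, \sum_k M i k * v k = 0
    & forall x, indexed_solution idfun x ->
        exists t, forall k, zvec x k = zvec x0 k + t * v k].
Proof.
move=> x0sol; have rk1 := ker_rank_le1 x0sol.
(* [A] has n + 2 rows and n + 1 columns. *)
have W0 : kermx A != 0.
  by rewrite -mxrank_eq0 mxrank_ker subn_eq0 -ltnNge ltnS (leq_trans (rank_leq_col A)) ?addn1.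
have vW : (nz_row (kermx A) <= kermx A)%MS by exact: nz_row_sub.
have [v_i0 vM] := sub_kermxA vW.
exists (nz_row (kermx A) 0); split=> // [|x xsol].
  apply: contrapT => /forallNP vN; move: W0; rewrite -nz_row_eq0 => /eqP; apply.
  by apply/rowP => k; rewrite [RHS]mxE; have /negP := vN k; rewrite negbK => /eqP.
have Wv : (kermx A <= nz_row (kermx A))%MS.
  have [_ <-] := mxrank_leqif_sup vW.
  by rewrite eqn_leq mxrankS //= rank_rV nz_row_eq0 W0.
have /sub_rVP[t tE] := submx_trans (zvec_diff xsol x0sol) Wv.
exists t => k; have := congr1 (fun w : 'rV[R]_n.+2 => w 0 k) tE.
by rewrite !mxE => <-; rewrite addrC subrK.
Qed.

Section Line.
Variables (y v : 'I_n.+2 -> R).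
Let K := [set k | (lam k != 0) && (v k != 0)]%SET.
Let c k := - (y k / v k).

(** The factors with v_k = 0 are constant; [C] collects them together with the leading coefficients
    v_k of the moving ones. *)
Lemma line_prod : exists C, forall t,
  \prod_k (y k + t * v k) ^ lam k = C * rprod c lam K t.
Proof.
exists (\prod_k (if k \in K then v k else y k) ^ lam k) => t.
rewrite /rprod [\prod_(k in K) _]big_mkcond -big_split; apply: eq_bigr => k _ /=.
rewrite inE; case: eqP => [->|_] /=; first by rewrite !expr0z mulr1.
case: eqP => [->|/eqP vk]; first by rewrite mulr0 addr0 mulr1.
by rewrite -expfzMl /c; congr (_ ^ _); field.
Qed.

(** Otherwise the product would remain 1 on a segment of the line, giving infinitely many real,
    hence complex, solutions. *)
Lemma line_lognum_neq0 : (forall k, y k != 0) -> \prod_k y k ^ lam k = 1 ->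
  y i0 = 1 -> v i0 = 0 -> (exists k, v k != 0) ->
  (forall i, \sum_k M i k * y k = 0) -> (forall i, \sum_k M i k * v k = 0) ->
  lognum c lam K != 0.
Proof.
move=> y0 y1 yi0 vi0 [k0 vk0] yM vM; apply/eqP => K0.
have [|d d0 dP] := lognum0_const _ K0 (t0 := 0).
  by move=> k; rewrite inE => /andP[_ vk]; rewrite eq_sym oppr_eq0 mulf_neq0 ?invr_eq0.
pose C := real_complex R.
have [|rho rho0 rhoP] := nonvanishing_radius (y := fun k => C (y k))
    (fun k => C (v k)) (fun k => 0).
  by move=> k; rewrite fmorph_eq0.
pose e := Num.min d rho; have e0 : 0 < e by rewrite lt_min d0.
have se i : 0 < e / i.+2%:R < e.
  by rewrite divr_gt0 //= ltr_pdivrMr // ltr_pMr // ltr1n.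
pose z (i : nat) k := C (y k + e / i.+2%:R * v k).
apply: (@no_infinite_family z i0 1) => [i j zij|i k|i|i|i j].
- have /complexI/addrI/(mulIf vk0) := congr1 (fun f => f k0) zij.
  by move=> /(mulfI (lt0r_neq0 e0)) /invr_inj /eqP; rewrite eqr_nat => /eqP [].
- have /andP[s0 s1] := se i.
  have s_rho : Normc.normc (C (e / i.+2%:R)) < rho.
    by rewrite normc_real gtr0_norm // (lt_le_trans s1) // ge_min lexx orbT.
  have := rhoP _ 0 s_rho; rewrite [Normc.normc 0]ComplexField.Normc.normc0.
  move=> /(_ rho0 k); rewrite mul0r addr0.
  by rewrite /z /C -rmorphM -rmorphD.
- by rewrite /z yi0 vi0 mulr0 addr0 /C rmorph1.
- rewrite real_complex_prod; have [C' CE] := line_prod; rewrite CE.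
  have /andP[s0 s1] := se i.
  have [|_] := dP (e / i.+2%:R); first by rewrite s0 (lt_le_trans s1) // ge_min lexx.
  rewrite add0r => ->; rewrite -CE -[RHS](rmorph1 C); congr (C _).
  by rewrite -[RHS]y1; apply: eq_bigr => k _; rewrite mul0r addr0.
transitivity (C (\sum_k M j k * y k) + C (e / i.+2%:R) * C (\sum_k M j k * v k)).
  rewrite /C !rmorph_sum !mulr_sumr -big_split; apply: eq_bigr => k _ /=.
  by rewrite /z /C !(rmorphM, rmorphD) /=; ring.
by rewrite yM vM /C rmorph0 mulr0 addr0.
Qed.
End Line.

Lemma size_real_solutions_base (xs : seq 'rV[R]_n) : uniq xs ->
  {in xs, forall x, @indexed_solution R idfun x} ->
  (size xs <= 2 * #|[set k | lam k != 0]%SET| - 3)%N.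
Proof.
case: xs => // x0 xs'; set xs := x0 :: xs' => xs_uniq xs_sol.
have x0sol : indexed_solution idfun x0 by apply: xs_sol; rewrite mem_head.
have [v [v_i0 v0 vM vP]] := ker_direction x0sol.
have /choice[t tP] : forall x, exists t, indexed_solution idfun x ->
    forall k, zvec x k = zvec x0 k + t * v k.
  move=> x; have [xsol|?] := pselect (indexed_solution idfun x).
    by have [t ?] := vP x xsol; exists t.
  by exists 0.
pose K := [set k | (lam k != 0) && (v k != 0)]%SET.
pose c k := - (zvec x0 k / v k).
have K0 : lognum c lam K != 0.
  apply: line_lognum_neq0 => //; rewrite ?zvec_i0 ?zvec_prod //.
    by move=> k; exact: zvec_neq0.
  by move=> i; exact: zvec_M.
have [C CP] := line_prod (zvec x0) v.
have [d [d0 d1]] := affine_coordinates span.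
pose ts := sort <=%R (map t xs).
have ts_sorted : sorted <%R ts.
  rewrite sort_lt_sorted map_inj_in_uniq // => x y xxs yxs txy.
  have [xsol ysol] := (xs_sol x xxs, xs_sol y yxs).
  apply: (@torus_inj R n _ a d (a i0) x y d0 d1).
  - by case: xsol.
  - by case: ysol.
  - by move=> k; rewrite -/(zvec x k) -/(zvec y k) (tP x xsol) (tP y ysol) txy.
have ts_c u k : u \in ts -> k \in K -> u != c k.
  rewrite mem_sort => /mapP[x xxs ->]; rewrite inE => /andP[_ vk].
  have := zvec_neq0 k (xs_sol x xxs); rewrite (tP _ (xs_sol x xxs)).
  by apply: contra => /eqP ->; apply/eqP; rewrite /c; field.
have ts_level u : u \in ts -> C * rprod c lam K u = 1.
  rewrite mem_sort => /mapP[x xxs ->]; rewrite -CP -[RHS](zvec_prod (xs_sol x xxs)).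
  by apply: eq_bigr => k _; rewrite (tP _ (xs_sol x xxs)).
have -> : size xs = size ts by rewrite size_sort size_map.
pose S := [set k | lam k != 0]%SET.
have lam_i0 : lam i0 != 0 by apply: contraTneq i0_odd => ->.
have KS : K \subset S :\ i0.
  apply/fintype.subsetP => k; rewrite !inE => /andP[-> vk]; rewrite andbT.
  by apply: contraNneq vk => ->; rewrite v_i0.
have cardS : #|S| = #|S :\ i0|.+1 by rewrite (cardsD1 i0 S) inE lam_i0.
have dbl := leq_size_level_double ts_sorted ts_c ts_level K0.
rewrite -/S cardS; have [KE|KnE] := eqVneq K (S :\ i0).
  have [l lK lodd] : exists2 l, l \in K & odd `|lam l|%N.
    apply: contrapT => /forall2NP evenK; move: i0_odd; apply/negP.
    have := lam_sum; rewrite (bigD1 i0) //= => /eqP; rewrite addr_eq0 => /eqP ->.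
    rewrite abszN -dvdn2; suff : (2 %| \sum_(k | k != i0) lam k)%Z by rewrite dvdzE.
    apply: rpred_sum => k ki0; rewrite -[_ \in _]/(2 %| lam k)%Z dvdzE dvdn2.
    apply/negP => kodd; have [|//] := evenK k; apply.
    by rewrite KE !inE ki0; apply: contraTneq kodd => ->.
  have := leq_size_level_odd ts_sorted ts_c ts_level K0 lK lodd.
  by rewrite KE; move: #|_| (size ts) => p q; lia.
have : (#|K| < #|S :\ i0|)%N.
  by apply: proper_card; rewrite finset.properEneq KnE.
by move: dbl; move: #|K| #|_| (size ts) => p q r; lia.
Qed.
End WithBasePoint.

Lemma size_real_solutions (xs : seq 'rV[R]_n) : uniq xs ->
  {in xs, forall x, @indexed_solution R idfun x} ->
  (size xs <= 2 * #|[set k | lam k != 0]%SET| - 3)%N.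
Proof.
have [l lodd] := lam_odd; exact: (size_real_solutions_base lodd).
Qed.
End CircuitSystem.

(** * Cardinalities, enumeration of the circuit, and the bounds for Laurent systems *)

Lemma size_le_card (T : choiceType) (A : set T) (N : nat) (s : seq T) :
  A #<= `I_N -> uniq s -> {in s, forall x, A x} -> (size s <= N)%N.
Proof.
move=> AN us sA; rewrite -card_le_II; apply: card_le_trans AN.
have : [set` [fset x in s]%fset] #= `I_(size s).
  by apply/card_eq_fsetP; rewrite card_fseq undup_id.
rewrite card_eq_le => /andP[_ /card_le_trans]; apply; apply: subset_card_le.
by move=> x /=; rewrite inE => /sA.
Qed.

Lemma card_le_size (T : choiceType) (A : set T) (N : nat) :
  (forall s : seq T, uniq s -> {in s, forall x, A x} -> (size s <= N)%N) ->
  A #<= `I_N.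
Proof.
move=> sN; have [/finite_fsetP[X AX]|/infinite_set_fsetP/(_ N.+1)[B BA]] :=
    pselect (finite_set A).
  apply: (@card_le_trans _ _ _ `I_(#|` X|)).
    have : [set` X] #= `I_(#|` X|) by apply/card_eq_fsetP.
    by rewrite AX card_eq_le => /andP[].
  by rewrite card_le_II; apply: sN => // x xX; rewrite AX.
by rewrite ltnNge sN // => x xB; exact: BA.
Qed.

Section FsetEnumeration.
Variables (T : choiceType) (x0 : T) (C : {fset T}) (m : nat).
Hypothesis cardC : #|` C| = m.

Definition fset_nth (k : 'I_m) := nth x0 C k.

Lemma fset_nth_inj : injective fset_nth.
Proof.
move=> i j /eqP; rewrite nth_uniq ?cardC ?fset_uniq // => /eqP.
exact: val_inj.
Qed.

Lemma fset_nthP x : x \in C -> exists k, x = fset_nth k.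
Proof.
by move=> /(nthP x0)[k]; rewrite cardC => km <-; exists (Ordinal km).
Qed.

Lemma big_fset_nth (V : nmodType) (f : T -> V) :
  \sum_(x <- C) f x = \sum_k f (fset_nth k).
Proof. by rewrite (big_nth x0) big_mkord cardC. Qed.
End FsetEnumeration.

Lemma laurent_evalE (R : realType) n (K : fieldType) (iota : R -> K)
    (f : laurent R n) (A : {fset 'rV[int]_n}) x :
  iota 0 = 0 -> (finsupp f `<=` A)%fset ->
  laurent_eval iota f x = \sum_(b <- A) iota (f b) * monom x b.
Proof.
move=> iota0 fA; apply: big_fset_incl => // b _ bf.
by rewrite fsfun_dflt // iota0 mul0r.
Qed.

(** Relations over every [numDomainType] are covered because two rings occur below: the integers for
    the relation lifted in (i), and [R] for non-degeneracy. *)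
Lemma circuit_real_bound (R : realType) n (C : {fset 'rV[int]_n})
    (F : 'I_n -> laurent R n) (cardC : #|` C| = n.+2) :
  primitive C -> generic_system C F ->
  exists lam : 'I_n.+2 -> int, [/\ exists l, lam l != 0,
    forall (K : numDomainType) (rho : 'rV[int]_n -> K),
      \sum_(b <- C) rho b = 0 -> \sum_(b <- C) rho b *: map_mx intr b = 0 ->
      exists p, forall k, rho (fset_nth 0 C k) = p * (lam k)%:~R
    & real_solutions F #<= `I_(2 * #|[set k | lam k != 0]%SET| - 3)].
Proof.
move=> primC [suppF [N solF _]].
pose a (k : 'I_n.+2) := fset_nth 0 C k.
have span x : exists2 c : 'I_n.+2 -> int,
    \sum_k c k = 1 & x = \sum_k c k *: a k.
  have : affine_span int C x by rewrite primC.
  case=> c; rewrite !(big_fset_nth 0 cardC) => c1 xE.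
  exists (c \o a) => //; rewrite xE; apply: eq_bigr => k _.
  by congr (_ *: _); apply/rowP => j; rewrite mxE intz.
have [lam [lam0 lam1 [l lodd] lamP]] := circuit_relation span.
exists lam; split.
- by exists l; apply: contraTneq lodd => ->.
- move=> K rho; rewrite !(big_fset_nth 0 cardC) => rho0 rho1.
  exact: (lamP K (fun k => rho (a k))).
have solE (K : fieldType) (iota : R -> K) : iota 0 = 0 ->
    torus_solutions iota F =
    [set x | indexed_solution a (fun i k => F i (a k)) iota x].
  move=> iota0; apply/seteqP; split=> x [x0 xF]; split=> // i; have := xF i;
    by rewrite (laurent_evalE _ iota0 (suppF i)) (big_fset_nth 0 cardC).
apply: card_le_size => xs uxs xsF.
apply: (@size_real_solutions R n a (fun i k => F i (a k)) lam span lam0 lam1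
    (ex_intro _ l lodd) _ N) => //.
- move=> rho rho0 rho1; have [|p pE] := lamP int rho rho0.
    rewrite -[RHS]rho1; apply: eq_bigr => k _; congr (_ *: _).
    by apply/rowP => j; rewrite mxE intz.
  by exists p => k; rewrite pE intz.
- move=> ys uys ysP; apply: (@size_le_card _ (complex_solutions F)) => //.
    by move: solF; rewrite card_eq_le => /andP[].
  by move=> y yys; rewrite /complex_solutions solE //; exact: ysP.
- by move=> x xxs; have := xsF x xxs; rewrite /real_solutions solE.
Qed.

Lemma circuit_real_bound_n (R : realType) n (C : {fset 'rV[int]_n})
    (F : 'I_n -> laurent R n) :
  is_circuit R C -> primitive C -> generic_system C F ->
  real_solutions F #<= `I_(2 * n + 1).
Proof.
move=> [cardC _] primC genF.
have [lam [_ _ /card_le_trans]] := circuit_real_bound cardC primC genF; apply.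
rewrite card_le_II; have := max_card [set k | lam k != 0]%SET.
by rewrite card_ord; move: #|_| => s; lia.
Qed.

(** From 2 s - 3 >= 2 n + 1 all lam_k are nonzero. A relation on a proper subset, extended by zero,
    is p lam; it vanishes at an omitted point, so p = 0. *)
Lemma maximal_circuit_nondegenerate (R : realType) n (C : {fset 'rV[int]_n})
    (F : 'I_n -> laurent R n) :
  is_circuit R C -> primitive C -> generic_system C F ->
  real_solutions F #= `I_(2 * n + 1) -> nondegenerate_config R C.
Proof.
move=> [cardC _] primC genF cardF B BC [c [[b bB cb0] c0 c1]].
have [lam [_ lamP bound]] := circuit_real_bound cardC primC genF.
have lam_neq0 k : lam k != 0.
  have : `I_(2 * n + 1) #<= `I_(2 * #|[set k | lam k != 0]%SET| - 3).
    by apply: card_le_trans bound; move: cardF; rewrite card_eq_le => /andP[].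
  rewrite card_le_II => le; have : [set k | lam k != 0]%SET == [set: 'I_n.+2]%SET.
    rewrite eqEcard finset.subsetT cardsT card_ord.
    by move: le; move: #|_| => s; lia.
  by move=> /eqP/setP/(_ k); rewrite !inE.
pose rho x := if x \in B then c x else 0.
have BC' := fproper_sub BC.
have sumE (V : nmodType) (f : 'rV[int]_n -> V) :
    \sum_(x <- C) (if x \in B then f x else 0) = \sum_(x <- B) f x.
  rewrite -(big_fset_incl _ BC') => [|x _ /negPf ->] //.
  by rewrite big_seq [RHS]big_seq; apply: eq_bigr => x ->.
have [||p pE] := lamP R rho; first by rewrite sumE.
  rewrite -[RHS]c1 -sumE; apply: eq_bigr => x _.
  by rewrite /rho; case: ifP => // _; rewrite scale0r.
have [x xC xB] : exists2 x, x \in C & x \notin B.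
  by have := BC; rewrite fproperE => /andP[_ /fsubsetPn].
have [k xk] := fset_nthP 0 cardC xC; have [l bl] := fset_nthP 0 cardC (fsubsetP BC' b bB).
have := pE k; rewrite -xk /rho (negPf xB) => /esym/eqP.
rewrite mulf_eq0 intr_eq0 (negPf (lam_neq0 k)) orbF => /eqP p0.
by have := pE l; rewrite -bl /rho bB p0 mul0r => /eqP; rewrite (negPf cb0).
Qed.

(** The relation between the v_i lifts to an affine relation [rho] carried by 0, l e_n and the w_i
    with alpha_i nonzero. It is a nonzero multiple of [lam], so s <= nu + 2. *)
Lemma vertical_circuit_real_bound (R : realType) n (l : int)
    (w : 'I_n -> 'rV[int]_n) (alpha : 'I_n -> int) (F : 'I_n -> laurent R n) :
  (2 <= n)%N -> 1 <= l ->
  is_circuit R (vertical_config l w) -> primitive (vertical_config l w) ->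
  off_vertical_axis R w -> coprime_relation w alpha ->
  generic_system (vertical_config l w) F ->
  real_solutions F #<= `I_(2 * relation_length alpha + 1).
Proof.
move=> n2 l1 [cardC _] primC offw [alpha_rel alpha_gcd] genF.
set C := vertical_config l w in cardC primC genF.
have [lam [_ lamP bound]] := circuit_real_bound cardC primC genF.
apply: card_le_trans bound _; rewrite card_le_II.
have n0 : (0 < n)%N by exact: ltn_trans n2.
pose e := e_last int n.
have wC i : w i \in C by rewrite !inE; apply/orP; right; apply: in_imfset.
have w_axis i t : w i != t *: e.
  apply/eqP => wE; apply: (offw i t%:~R); rewrite wE.
  by apply/rowP => j; rewrite !mxE intrM; congr (_ * _); exact: rmorph_nat.
have w_neq0 i : w i != 0 by have := w_axis i 0; rewrite scale0r.
(* At most two of the n + 2 points lie outside the image of [w], which therefore has n elements. *)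
have w_inj : injective w.
  apply/injectiveP; rewrite -[injectiveb w]/(uniq (map w (enum 'I_n))) -[uniq _]negbK.
  rewrite -ltn_size_undup size_map size_enum_ord -leqNgt.
  have <- : #|` [fset w i | i in 'I_n]%fset| = size (undup (map w (enum 'I_n))).
    rewrite -card_fseq; congr (size (enum_fset _)); apply/fsetP => x.
    rewrite !inE; apply/imfsetP/mapP => [[i _ ->]|[i _ ->]]; exists i => //.
    by rewrite mem_enum.
  have := leq_card_fsetU [fset 0; l *: e]%fset [fset w i | i in 'I_n]%fset.
  rewrite -/C cardC cardfs2 => le.
  by have := leq_trans le (leq_add (_ : (_ <= 2)%N) (leqnn _));
    rewrite !ltnS; apply; case: eqP.
have ltn1 : (n.-1 < n)%N by rewrite ltn_predL.
pose last_w i := w i 0 (Ordinal ltn1).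
(* After scaling by [l], the weight [beta] at l e_n cancels the last coordinate, and [gamma] at 0
   makes the weights sum to zero. *)
pose beta := - \sum_i alpha i * last_w i.
pose gamma := - (l * \sum_i alpha i) - beta.
have alpha_w : \sum_i alpha i *: w i = - beta *: e.
  apply/rowP => j; rewrite !mxE summxE; case: eqP => [jn|/eqP jn].
    rewrite mulr1 opprK; apply: eq_bigr => i _; rewrite mxE /last_w.
    by congr (_ * w i 0 _); apply: val_inj.
  rewrite mulr0; have jn' : (j < n.-1)%N by rewrite ltn_neqAle jn -ltnS prednK //=.
  have /rowP/(_ (Ordinal jn')) := alpha_rel; rewrite [RHS]mxE summxE => aj.
  rewrite -[RHS]aj; apply: eq_bigr => i _; rewrite !mxE.
  by congr (_ * w i 0 _); apply: val_inj.
pose del (u x : 'rV[int]_n) : int := (x == u)%:R.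
pose rho x := \sum_i l * alpha i * del (w i) x + beta * del (l *: e) x + gamma * del 0 x.
have del1 u : u \in C -> \sum_(x <- C) del u x = 1.
  move=> uC; rewrite (big_fsetD1 u) //= /del eqxx big1_fset ?addr0 // => x.
  by rewrite !inE => /andP[/negPf ->].
have delx u : u \in C -> \sum_(x <- C) del u x *: x = u.
  move=> uC; rewrite (big_fsetD1 u) //= /del eqxx scale1r big1_fset ?addr0 // => x.
  by rewrite !inE => /andP[/negPf ->]; rewrite scale0r.
have zC : 0 \in C by rewrite !inE eqxx.
have eC : l *: e \in C by rewrite !inE eqxx orbT.
have rho0 : \sum_(x <- C) rho x = 0.
  rewrite !big_split /= exchange_big /= -!mulr_sumr !del1 // !mulr1.
  under eq_bigr do rewrite -mulr_sumr del1 // mulr1.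
  by rewrite -mulr_sumr /gamma; ring.
have rho1 : \sum_(x <- C) rho x *: map_mx intr x = 0 :> 'rV[int]_n.
  transitivity (\sum_i (l * alpha i) *: (\sum_(x <- C) del (w i) x *: x) +
      beta *: (\sum_(x <- C) del (l *: e) x *: x) +
      gamma *: (\sum_(x <- C) del 0 x *: x)).
    under [X in _ = X + _ + _]eq_bigr do rewrite scaler_sumr.
    rewrite exchange_big !scaler_sumr -!big_split /=; apply: eq_bigr => x _.
    have -> : map_mx intr x = x by apply/rowP => j; rewrite mxE intz.
    rewrite /rho; move: (beta) (gamma) => b g.
    rewrite !scalerDl scaler_suml !scalerA; congr (_ + _ + _).
    by apply: eq_bigr => i _; rewrite scalerA.
  under eq_bigr => i _ do rewrite delx //.
  rewrite !delx // scaler0 addr0; under eq_bigr do rewrite -scalerA.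
  by rewrite -scaler_sumr alpha_w !scalerA -scalerDl mulrN mulrC addNr scale0r.
have rhow i : rho (w i) = l * alpha i.
  rewrite /rho /del (negPf (w_neq0 i)) (negPf (w_axis i l)) !mulr0 !addr0.
  rewrite (bigD1 i) //= eqxx mulr1 big1 ?addr0 // => j ji.
  by rewrite inj_eq // eq_sym (negPf ji) mulr0.
have [p pE] := lamP int rho rho0 rho1.
have [i alpha_i] : exists i, alpha i != 0.
  apply: contrapT => /forallNP a0; move: alpha_gcd; rewrite big1 // => i _.
  by apply/eqP; rewrite absz_eq0; have /negP := a0 i; rewrite negbK.
have p0 : p != 0.
  have [k wk] := fset_nthP 0 cardC (wC i); have := pE k; rewrite -wk rhow.
  apply: contra_eqN => /eqP ->; rewrite mul0r mulf_neq0 //.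
  by rewrite gt_eqF // (lt_le_trans _ l1).
suff : (#|[set k | lam k != 0]%SET| <= relation_length alpha + 2)%N.
  by rewrite /relation_length; move: #|_| #|_| => s t; lia.
rewrite cardE -(size_map (fun k : 'I_n.+2 => fset_nth 0 C k)).
have -> : (relation_length alpha + 2)%N =
    size [:: 0, l *: e & map w (enum [set i | alpha i != 0]%SET)].
  by rewrite /= size_map -cardE addn2.
apply: uniq_leq_size.
  by rewrite map_inj_uniq ?enum_uniq //; exact: fset_nth_inj cardC.
move=> _ /mapP[k + ->]; rewrite mem_enum inE => lamk.
have : rho (fset_nth 0 C k) != 0 by rewrite pE mulf_neq0 // intr_eq0.
apply: contraNT; rewrite !inE !negb_or => /and3P[x0 xe xw].
rewrite /rho /del (negPf x0) (negPf xe) !mulr0 !addr0 big1 // => j _.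
case: eqP => [xE|]; last by rewrite mulr0.
have [->|aj] := eqVneq (alpha j) 0; first by rewrite mulr0 mul0r.
by case/negP: xw; rewrite xE map_f // mem_enum inE.
Qed.

(** * Volume of a simplex *)

Section SimplexVolume.
Variable R : realType.

Lemma integral_deriv_poly (p : {poly R}) (a b : R) : a <= b ->
  (\int[lebesgue_measure]_(x in `[a, b]) (p^`().[x])%:E = (p.[b] - p.[a])%:E)%E.
Proof.
rewrite le_eqVlt => /predU1P[->|ab].
  by rewrite set_itv1 integral_set1 subrr.
rewrite EFinB; apply: continuous_FTC2 => //.
- apply: derivable_within_continuous => x _; exact: derivable_horner.
- split=> [x _||].
  + by have [] := is_derive_poly p x.
  + by apply: cvg_at_right_filter; exact: continuous_horner.
  + by apply: cvg_at_left_filter; exact: continuous_horner.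
- by move=> x _; rewrite derive1E; exact: derive_val.
Qed.

Lemma integral_pow_tail (a s k : R) m : 0 <= s ->
  (\int[lebesgue_measure]_(t in `[a, (a + s)%R]) (k * (a + s - t) ^+ m)%:E =
   (k * s ^+ m.+1 / m.+1%:R)%:E)%E.
Proof.
move=> s0; pose p : {poly R} := - (k / m.+1%:R) *: ((a + s)%:P - 'X) ^+ m.+1.
transitivity (\int[lebesgue_measure]_(t in `[a, (a + s)%R]) (p^`().[t])%:E)%E.
  apply: eq_integral => t _; congr EFin.
  rewrite /p derivZ deriv_exp derivB derivC derivX sub0r mulN1r mulNrn scalerN.
  rewrite scaleNr opprK -(scaler_nat _ (_ ^+ _)) scalerA divfK ?pnatr_eq0 //=.
  by rewrite hornerZ horner_exp hornerD hornerN hornerC hornerX.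
rewrite integral_deriv_poly ?lerDl // /p !hornerZ !horner_exp.
rewrite !(hornerD, hornerN, hornerC, hornerX) subrr expr0n mulr0 sub0r.
by rewrite mulNr opprK addrAC subrr add0r mulrAC.
Qed.

Lemma lebesgue_rV0 m : @lebesgue_rV R m set0 = 0%E.
Proof.
elim: m => [|m IH] /=; first by rewrite indic0.
by rewrite (eq_integral (cst 0%E)) ?integral0 // => t _; rewrite /cst -[RHS]IH.
Qed.

Definition corner_simplex m (b : 'rV[R]_m) (s : R) : set 'rV[R]_m :=
  [set y | (forall j, b 0 j <= y 0 j) /\ \sum_j (y 0 j - b 0 j) <= s].

Lemma corner_simplex0 m (b : 'rV[R]_m) s : s < 0 -> corner_simplex b s = set0.
Proof.
move=> s0; apply/seteqP; split=> // y [by_ sy]; move: s0.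
rewrite ltNge => /negP; apply; apply: le_trans sy.
by apply: sumr_ge0 => j _; rewrite subr_ge0.
Qed.

(** Shared by two volumes: the corner simplex itself (k = 1, fixed corner, by induction on
    dimension) and the hull of the sharp circuit, whose slices are corner simplices with a moving
    corner and k = 1 / N. *)
Lemma lebesgue_rV_slices m (A : set 'rV[R]_(1 + m)) (b : R -> 'rV[R]_m) (a s k : R) :
  0 < k -> 0 <= s ->
  (forall t, 0 <= k * (a + s - t) ->
     lebesgue_rV (corner_simplex (b t) (k * (a + s - t))) =
     ((k * (a + s - t)) ^+ m / m`!%:R)%:E) ->
  (forall t, a <= t -> [set y | A (row_mx (const_mx t) y)] =
     corner_simplex (b t) (k * (a + s - t))) ->
  (forall t, t < a -> [set y | A (row_mx (const_mx t) y)] = set0) ->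
  @lebesgue_rV R m.+1 A = (k ^+ m * s ^+ m.+1 / m.+1`!%:R)%:E.
Proof.
move=> k0 s0 vol slice noslice.
rewrite [LHS](_ : _ =
    \int[lebesgue_measure]_(t in `[a, (a + s)%R])
      (k ^+ m / m`!%:R * (a + s - t) ^+ m)%:E)%E.
  rewrite integral_pow_tail // factS natrM; congr EFin.
  by field; rewrite !pnatr_eq0 -!lt0n fact_gt0 /=.
rewrite [RHS]integral_mkcond /=; apply: eq_integral => t _; rewrite patchE.
case: ifPn; rewrite ?inE ?notin_setE /= in_itv /=.
  move=> /andP[at_ ts]; rewrite slice // vol.
    by congr EFin; rewrite exprMn mulrAC.
  by rewrite mulr_ge0 // ?subr_ge0 // ltW.
move=> /negP; rewrite negb_and -!ltNge => /orP[ta|st].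
  by rewrite noslice // lebesgue_rV0.
(* Beyond a + s the slice is a corner simplex of negative size, hence empty. *)
have [at_|ta] := leP a t; last by rewrite noslice // lebesgue_rV0.
by rewrite slice // corner_simplex0 ?lebesgue_rV0 // pmulr_rlt0 // subr_lt0.
Qed.

Lemma lebesgue_rV_corner_simplex m (b : 'rV[R]_m) s : 0 <= s ->
  lebesgue_rV (corner_simplex b s) = (s ^+ m / m`!%:R)%:E.
Proof.
elim: m b s => [|m IH] b s s0.
  rewrite /= expr0 fact0 divr1 indicE.
  rewrite mem_set //; split=> [[]//|].
  by rewrite big_ord0.
pose b0 := b 0 (@lshift 1 m ord0).
rewrite (@lebesgue_rV_slices m (@corner_simplex (1 + m) b s) (fun=> @rsubmx _ 1 1 m b) b0 s 1) //.
- by rewrite expr1n mul1r.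
- by move=> t; rewrite mul1r; exact: IH.
- move=> t bt; rewrite mul1r; apply/seteqP; split=> y [y1 y2]; split.
  + by move=> j; have := y1 (rshift 1 j); rewrite row_mxEr mxE.
  + move: y2; rewrite (@big_split_ord _ _ _ 1 m) big_ord1 /= row_mxEl mxE -/b0.
    under eq_bigr do rewrite row_mxEr; move=> y2.
    under eq_bigr do rewrite mxE.
    by move: y2; rewrite -lerBrDl opprB addrCA addrA.
  + move=> j; case: (split_ordP j) => i ->.
      by rewrite row_mxEl mxE ord1.
    by rewrite row_mxEr; have := y1 i; rewrite mxE.
  + have {}y2 : \sum_j (y 0 j - b 0 (rshift 1 j)) <= b0 + s - t.
      by apply: le_trans y2; under [leRHS]eq_bigr do rewrite mxE.
    rewrite (@big_split_ord _ _ _ 1 m) big_ord1 /= row_mxEl mxE -/b0.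
    under eq_bigr do rewrite row_mxEr.
    by rewrite -lerBrDl opprB addrCA addrA.
- move=> t tb; apply/seteqP; split=> // y [/(_ (lshift m ord0))].
  by rewrite row_mxEl mxE -/b0 leNgt tb.
Qed.
End SimplexVolume.

(** * Sharpness *)

Section ManyRoots.
Variables (R : realType) (n nu : nat).
Hypotheses (nu_gt0 : (0 < nu)%N) (nu_le : (nu <= n)%N).

(** The last nu - 1 indices; on them [tail_root] takes the values 1, ..., nu - 1. *)
Definition tail : {set 'I_n} := [set j : 'I_n | (n < j + nu)%N]%SET.

Definition tail_root (K : pzRingType) (j : 'I_n) : K := (j + nu - n)%:R.

Lemma card_tail : #|tail| = nu.-1.
Proof.
rewrite -sum1_card (reindex_inj rev_ord_inj) /=.
rewrite (eq_bigl (fun j : 'I_n => (j < nu.-1)%N)) => [|j]; last first.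
  by rewrite !inE /=; have := ltn_ord j; lia.
rewrite -(big_ord_widen _ (fun=> 1%N)) ?sum1_card ?card_ord //.
by move: nu_gt0 nu_le; lia.
Qed.

Definition double_root_poly : {poly R} :=
  ('X + 1) * 'X ^+ 2 * (\prod_(j in tail) ('X - (tail_root R j)%:P)) ^+ 2.

(** Less than the value of [double_root_poly] at each s = i - 1/2: there s + 1 >= 1/2, s^2 >= 1/4,
    and each of the at most n squared tail factors is at least 1/4. *)
Definition perturbation : R := (4^-1) ^+ n.+2.

Definition perturbed_poly := double_root_poly - perturbation%:P.

Lemma perturbation_gt0 : 0 < perturbation.
Proof. by rewrite exprn_gt0 // invr_gt0. Qed.

Lemma size_double_root_poly :
  size double_root_poly = (2 * nu + 2)%N /\ double_root_poly \is monic.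
Proof.
have X1 : 'X + 1 = 'X - (-1)%:P :> {poly R} by rewrite polyCN opprK.
pose P : {poly R} := \prod_(j in tail) ('X - (tail_root R j)%:P).
have mP : P \is monic by apply: monic_prod_XsubC.
have sP : size (P ^+ 2) = (2 * nu.-1).+1.
  have := size_exp P 2; rewrite /P -big_enum size_prod_XsubC -cardE card_tail /=.
  rewrite big_enum -/P => sP2; have : (0 < size (P ^+ 2))%N.
    by rewrite lt0n size_poly_eq0 expf_neq0 // monic_neq0.
  by move: sP2; case: size => //= s -> _; rewrite mulnC.
rewrite /double_root_poly -/P X1; split; last first.
  by rewrite !monicMl ?rpredX ?monicX ?monicXsubC.
have m1 : ('X - (-1)%:P) * 'X ^+ 2 \is @monic R.
  by rewrite monicMl ?monicXsubC ?rpredX ?monicX.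
have s1 : size (('X - (-1)%:P) * 'X ^+ 2 : {poly R}) = 4.
  by rewrite size_Mmonic ?polyXsubC_eq0 ?rpredX ?monicX // size_XsubC size_polyXn.
rewrite size_Mmonic ?monic_neq0 ?rpredX // s1 sP.
by move: nu_gt0; case: (nu) => // k _ /=; lia.
Qed.

Lemma horner_double_root_poly s : double_root_poly.[s] =
  (s + 1) * s ^+ 2 * (\prod_(j in tail) (s - tail_root R j)) ^+ 2.
Proof.
rewrite /double_root_poly !(hornerM, horner_exp, hornerD, hornerX, hornerC).
by rewrite horner_prod; under eq_bigr do rewrite hornerXsubC.
Qed.

Lemma perturbed_poly_integer i : (i <= nu)%N -> perturbed_poly.[i%:R - 1] < 0.
Proof.
move=> inu; rewrite /perturbed_poly hornerD hornerN hornerC horner_double_root_poly.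
suff -> : (i%:R - 1 + 1) * (i%:R - 1) ^+ 2 *
    (\prod_(j in tail) (i%:R - 1 - tail_root R j)) ^+ 2 = 0.
  by rewrite sub0r oppr_lt0 perturbation_gt0.
case: i inu => [|[|i]] inu; first by rewrite subrK !mul0r.
  by rewrite subrr expr0n mulr0 mul0r.
have jn : (i.+1 + n - nu < n)%N by lia.
have jT : Ordinal jn \in tail by rewrite inE /=; lia.
rewrite (bigD1 _ jT) /= /tail_root /=.
have -> : (i.+1 + n - nu + nu - n = i.+1)%N by lia.
by rewrite -[i.+2]addn1 natrD addrK subrr mul0r expr0n mulr0.
Qed.

Lemma half_integer_gap (i c : nat) : 4^-1 <= ((i%:R - 2^-1 - c%:R) ^+ 2 : R).
Proof.
have [ic|ci] := leqP i c.
  have : i%:R <= c%:R :> R by rewrite ler_nat.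
  move: (i%:R) (c%:R) => x y xy; rewrite -subr_ge0.
  have -> : (x - 2^-1 - y) ^+ 2 - 4^-1 = (y - x) * (y - x + 1) :> R by field.
  by rewrite mulr_ge0 ?subr_ge0 //; lra.
have : c%:R + 1 <= i%:R :> R by rewrite natr1 ler_nat.
move: (i%:R) (c%:R) => x y xy; rewrite -subr_ge0.
have -> : (x - 2^-1 - y) ^+ 2 - 4^-1 = (x - y) * (x - (y + 1)) :> R by field.
by rewrite mulr_ge0 ?subr_ge0 // (le_trans _ xy) // lerDl.
Qed.

Lemma perturbed_poly_half i : 0 < perturbed_poly.[i%:R - 2^-1].
Proof.
rewrite /perturbed_poly hornerD hornerN hornerC horner_double_root_poly subr_gt0.
have q0 : (0 : R) <= 4^-1 by rewrite invr_ge0.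
have prod_ge : (4^-1 : R) ^+ n <= (\prod_(j in tail) (i%:R - 2^-1 - tail_root R j)) ^+ 2.
  rewrite -prodrXl big_mkcond -[X in _ ^+ X]card_ord -prodr_const /=.
  apply: ler_prod => j _; rewrite q0 /=; case: ifP => _.
    exact: half_integer_gap.
  by lra.
have half : (2^-1 : R) <= i%:R - 2^-1 + 1.
  by have := ler0n R i; lra.
have sq := half_integer_gap i 0; rewrite subr0 in sq.
rewrite /perturbation -[n.+2]addn2 exprD mulrC.
apply: (@lt_le_trans _ _ (2^-1 * 4^-1 * 4^-1 ^+ n)).
  by rewrite ltr_pM2r ?exprn_gt0 ?invr_gt0 // expr2 ltr_pM2r ?invr_gt0 //; lra.
have h0 : (0 : R) <= 2^-1 by rewrite invr_ge0.
by rewrite ler_pM ?exprn_ge0 ?mulr_ge0 // ler_pM.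
Qed.

(** The signs alternate at -1, -1/2, 0, ..., nu - 1/2: negative at the integers, positive at the
    half-integers. The 2 nu + 1 intervals give as many roots as the degree. *)
Lemma perturbed_poly_roots : exists rs : seq R,
  [/\ uniq rs, size rs = (2 * nu + 1)%N
    & perturbed_poly = \prod_(r <- rs) ('X - r%:P)].
Proof.
pose a k : R := k%:R / 2 - 1.
have a_lt k l : (a k < a l) = (k < l)%N.
  by rewrite /a ltrD2r ltr_pM2r ?invr_gt0 // ltr_nat.
have sign k : (k < 2 * nu + 1)%N ->
    perturbed_poly.[a k] * perturbed_poly.[a k.+1] < 0.
  have a_even i : a i.*2 = i%:R - 1.
    by rewrite /a -mul2n natrM; field.
  have a_odd i : a i.*2.+1 = i%:R - 2^-1.
    by rewrite /a -natr1 -mul2n natrM; field.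
  move=> kn; rewrite -(odd_double_half k); case: (odd k) (odd_double_half k) => kE.
    rewrite add1n -doubleS a_odd a_even pmulr_rlt0 ?perturbed_poly_half //.
    by apply: perturbed_poly_integer; lia.
  rewrite add0n a_odd a_even nmulr_rlt0 ?perturbed_poly_half //.
  by apply: perturbed_poly_integer; lia.
have /choice[r rP] : forall k, exists r, (k < 2 * nu + 1)%N ->
    a k < r < a k.+1 /\ root perturbed_poly r.
  move=> k; case: (ltnP k (2 * nu + 1)) => [kn|_]; last by exists 0.
  have [||x xa px] := @polyrcf.poly_ivtoo _ perturbed_poly (a k) (a k.+1).
  - by rewrite ltW // a_lt.
  - exact: sign.
  by exists x => _; split=> //; move: xa; rewrite in_itv.
pose rs := map r (iota 0 (2 * nu + 1)).
have size_rs : size rs = (2 * nu + 1)%N by rewrite size_map size_iota.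
have r_lt k l : (k < l)%N -> (l < 2 * nu + 1)%N -> r k < r l.
  move=> kl ln; have [/andP[_ rk] _] := rP k (ltn_trans kl ln).
  have [/andP[rl _] _] := rP l ln; apply: lt_trans rk (le_lt_trans _ rl).
  by rewrite leNgt a_lt -leqNgt.
have uniq_rs : uniq rs.
  rewrite map_inj_in_uniq ?iota_uniq // => k l; rewrite !mem_iota /= add0n => kn ln E.
  by case: (ltngtP k l) => // kl; [have := r_lt k l kl ln|have := r_lt l k kl kn];
    rewrite E ltxx.
have [size_q monic_q] := size_double_root_poly.
have size_e : (size (- perturbation%:P) < size double_root_poly)%N.
  by rewrite size_polyN size_q (leq_ltn_trans (size_polyC_leq1 _)) // addn2.
exists rs; split=> //; rewrite -[RHS]scale1r.
have <- : lead_coef perturbed_poly = 1.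
  by rewrite /perturbed_poly lead_coefDl // (monicP monic_q).
apply: all_roots_prod_XsubC; last by rewrite uniq_rootsE.
  by rewrite /perturbed_poly size_polyDl // size_q size_rs addn2 addn1.
apply/allP => _ /mapP[k + ->]; rewrite mem_iota add0n => /andP[_ kn].
by have [] := rP k kn.
Qed.
End ManyRoots.

(** * The sharp circuit and its volume *)

Section SharpConfiguration.
Variables (m nu : nat).
Local Notation n := m.+1.
Hypotheses (nu_gt0 : (0 < nu)%N) (nu_le : (nu <= n)%N).
Local Notation tail := (tail n nu).

Definition unit_vec (j : 'I_n) : 'rV[int]_n := delta_mx 0 j.

(* Chosen so that w + 2 (sum of e_j over the tail) + 2 * 0 = (2 nu + 1) e_0. *)
Definition apex : 'rV[int]_n :=
  \row_j (if j == ord0 then (2 * nu + 1)%N%:Z else if j \in tail then -2 else 0).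

Definition sharp_points : seq 'rV[int]_n :=
  [:: 0, apex & map unit_vec (enum 'I_n)].

Definition sharp_config : {fset 'rV[int]_n} := [fset x in sharp_points]%fset.

Lemma ord0_tail : ord0 \notin tail.
Proof. by rewrite inE /= add0n -leqNgt. Qed.

Lemma unit_vecE i j : unit_vec i 0 j = (j == i)%:R.
Proof. by rewrite mxE eqxx. Qed.

Lemma unit_vec_inj : injective unit_vec.
Proof.
by move=> i j /rowP/(_ i); rewrite !unit_vecE eqxx; case: eqP.
Qed.

Lemma unit_vec_neq0 j : unit_vec j != 0.
Proof. by apply/eqP => /rowP/(_ j); rewrite unit_vecE mxE eqxx. Qed.

Lemma apex0 : apex 0 ord0 = (2 * nu + 1)%N%:Z.
Proof. by rewrite mxE eqxx. Qed.

Lemma apex_neq0 : apex != 0.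
Proof. by apply/eqP => /rowP/(_ ord0); rewrite apex0 mxE; lia. Qed.

Lemma apex_neq_unit j : apex != unit_vec j.
Proof.
apply/eqP => /rowP/(_ ord0); rewrite apex0 unit_vecE.
by move: nu_gt0; case: eqP; lia.
Qed.

Lemma uniq_sharp_points : uniq sharp_points.
Proof.
rewrite /sharp_points /= inE negb_or eq_sym apex_neq0 /=.
rewrite map_inj_uniq ?enum_uniq ?andbT; last exact: unit_vec_inj.
apply/andP; split; apply/mapP => -[j _ E].
  by have := unit_vec_neq0 j; rewrite -E eqxx.
by have := apex_neq_unit j; rewrite E eqxx.
Qed.

Lemma mem_sharp0 : 0 \in sharp_config.
Proof. by rewrite !inE eqxx. Qed.

Lemma mem_apex : apex \in sharp_config.
Proof. by rewrite !inE eqxx orbT. Qed.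

Lemma mem_unit_vec j : unit_vec j \in sharp_config.
Proof. by rewrite !inE map_f ?orbT // mem_enum. Qed.

Lemma big_sharp_config (V : nmodType) (f : 'rV[int]_n -> V) :
  \sum_(x <- sharp_config) f x = f 0 + (f apex + \sum_j f (unit_vec j)).
Proof.
rewrite (perm_big sharp_points) /=; last first.
  apply: uniq_perm => [||x]; rewrite ?fset_uniq ?uniq_sharp_points //.
  by rewrite -[LHS]/(x \in sharp_config) in_fset.
by rewrite !big_cons big_map big_enum.
Qed.

Lemma card_sharp_config : #|` sharp_config| = n.+2.
Proof.
by rewrite card_fseq undup_id ?uniq_sharp_points //= size_map size_enum_ord.
Qed.

Section Weights.
Variables (K : pzRingType) (z b : K) (d : 'I_n -> K).

(** Combinations are indexed by all integer vectors, so weights given on the points must be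
    extended; the sum selects the j with x = e_j and is 0 off the circuit. *)
Definition weights (x : 'rV[int]_n) : K :=
  if x == 0 then z else if x == apex then b
  else \sum_(j | x == unit_vec j) d j.

Lemma weights0 : weights 0 = z. Proof. by rewrite /weights eqxx. Qed.

Lemma weights_apex : weights apex = b.
Proof. by rewrite /weights (negPf apex_neq0) eqxx. Qed.

Lemma weights_unit j : weights (unit_vec j) = d j.
Proof.
rewrite /weights (negPf (unit_vec_neq0 j)) eq_sym (negPf (apex_neq_unit j)).
by rewrite (big_pred1 j) // => i; rewrite (inj_eq unit_vec_inj) eq_sym.
Qed.

Lemma sum_weights :
  \sum_(x <- sharp_config) weights x = z + (b + \sum_j d j).
Proof.
rewrite big_sharp_config weights0 weights_apex; congr (_ + (_ + _)).
by apply: eq_bigr => j _; rewrite weights_unit.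
Qed.

End Weights.

Lemma combination_coord (K : pzRingType) (c : 'rV[int]_n -> K) j :
  (\sum_(x <- sharp_config) c x *: map_mx intr x : 'rV[K]_n) 0 j =
  c apex * (apex 0 j)%:~R + c (unit_vec j).
Proof.
rewrite big_sharp_config !mxE summxE mulr0 add0r; congr (_ + _).
rewrite (bigD1 j) //= big1 ?addr0 => [|i ij].
  by rewrite mxE mxE unit_vecE eqxx mulr1.
by rewrite mxE mxE unit_vecE eq_sym (negPf ij) mulr0.
Qed.

Lemma affine_span_sharp_config (K : pzRingType) :
  affine_span K sharp_config = [set: 'rV[K]_n].
Proof.
apply/seteqP; split=> // x _.
exists (weights (1 - \sum_j x 0 j) 0 (x 0)).
  by rewrite sum_weights add0r subrK.
by apply/rowP => j; rewrite combination_coord weights_apex mul0r add0r weights_unit.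
Qed.

Lemma sharp_is_circuit (R : realType) : is_circuit R sharp_config.
Proof. by split; [exact: card_sharp_config|exact: affine_span_sharp_config]. Qed.

Lemma sharp_primitive : primitive sharp_config.
Proof. exact: affine_span_sharp_config. Qed.

Section Volume.
Variable R : realType.
Let N : R := (2 * nu + 1)%:R.

Let N_gt0 : 0 < N. Proof. by rewrite ltr0n addn1. Qed.

(** The point with first coordinate t on the line through 0 and the apex, with that coordinate
    dropped. *)
Let corner (t : R) : 'rV[R]_m :=
  \row_j (- (2 * (t / N) * (lift ord0 j \in tail)%:R)).

Lemma sum_lift_tail : \sum_(j < m) (lift ord0 j \in tail)%:R = nu.-1%:R :> R.
Proof.
rewrite -(card_tail nu_gt0 nu_le) -sum1_card natr_sum [RHS]big_mkcond [RHS]big_ord_recl /=.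
rewrite (negPf ord0_tail) add0r; apply: eq_bigr => j _.
by case: ifP.
Qed.

Lemma hull_coord (x : 'rV[R]_n) : convex_hull R sharp_config x <->
  exists z b (d : 'I_n -> R), [/\ [/\ 0 <= z, 0 <= b & forall j, 0 <= d j],
    z + (b + \sum_j d j) = 1 & forall j, x 0 j = b * (apex 0 j)%:~R + d j].
Proof.
split=> [[c [c0 c1 cx]]|[z [b [d [[z0 b0 d0] s1 xE]]]]].
  exists (c 0), (c apex), (fun j => c (unit_vec j)); split.
  - by split=> [||j]; rewrite c0 ?mem_sharp0 ?mem_apex ?mem_unit_vec.
  - by rewrite -[RHS]c1 big_sharp_config.
  - by move=> j; rewrite cx combination_coord.
exists (weights z b d); split.
- move=> x' x'C; rewrite /weights; case: ifP => // _; case: ifP => // _.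
  by apply: sumr_ge0.
- by rewrite sum_weights.
- by apply/rowP => j; rewrite combination_coord weights_apex weights_unit xE.
Qed.

Lemma row_mx_ord0 (t : R) (y : 'rV[R]_m) :
  (row_mx (const_mx t : 'rV_1) y : 'rV[R]_n) 0 ord0 = t.
Proof.
have -> : ord0 = lshift m ord0 :> 'I_(1 + m) by apply: val_inj.
by rewrite (@row_mxEl _ _ 1 m) mxE.
Qed.

Lemma row_mx_lift (t : R) (y : 'rV[R]_m) j :
  (row_mx (const_mx t : 'rV_1) y : 'rV[R]_n) 0 (lift ord0 j) = y 0 j.
Proof.
have -> : lift ord0 j = rshift 1 j :> 'I_(1 + m) by apply: val_inj.
by rewrite (@row_mxEr _ _ 1 m).
Qed.

Lemma apex_lift (j : 'I_m) : apex 0 (lift ord0 j) =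
  - (2 * (lift ord0 j \in tail)%:R).
Proof. by rewrite mxE /=; case: ifP. Qed.

(** e_0 is a convex combination of 0, the apex and the tail e_j, so the hull is the simplex on 0,
    the apex and the e_j with j > 0. Its slice has its corner on the line through 0 and the apex,
    and size 1 - t / N. *)
Lemma hull_slice (t : R) : 0 <= t ->
  [set y | convex_hull R sharp_config (row_mx (const_mx t : 'rV_1) y)] =
  corner_simplex (corner t) (N^-1 * (0 + N - t)).
Proof.
have N0 := N_gt0; have N_neq0 : N != 0 by rewrite gt_eqF.
move=> t0; apply/seteqP; split=> y /=.
  move=> /hull_coord[z [b [d [[z0 b0 d0] s1 xE]]]].
  have tE : t = b * N + d ord0 by rewrite -(row_mx_ord0 t y) xE apex0.
  have yE j : y 0 j = - (2 * b * (lift ord0 j \in tail)%:R) + d (lift ord0 j).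
    rewrite -(row_mx_lift t y) xE apex_lift rmorphN rmorphM /= !rmorph_nat.
    by rewrite mulrN mulrCA mulrA.
  have gap j : y 0 j - corner t 0 j =
      d (lift ord0 j) + 2 * (d ord0 / N) * (lift ord0 j \in tail)%:R.
    by rewrite yE mxE tE; field.
  split=> [j|].
    rewrite -subr_ge0 gap addr_ge0 // mulr_ge0 // mulr_ge0 //.
    by rewrite divr_ge0 // ltW.
  under eq_bigr do rewrite gap.
  rewrite big_split /= -mulr_sumr sum_lift_tail add0r mulrBr mulVf // tE.
  have := s1; rewrite big_ord_recl /= => s1'.
  have -> : \sum_(j < m) d (lift ord0 j) = 1 - z - b - d ord0 by rewrite -[1]s1'; ring.
  have -> : N^-1 * (b * N + d ord0) = b + d ord0 / N by field.
  (* Spreading the weight d_0 of e_0 over the vertices of the simplex leaves the slack z + 2 d_0 / N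
     in the inequality. *)
  have nuE : 2 * nu.-1%:R = N - 3.
    apply/eqP; rewrite eq_sym subr_eq /N -natrM -natrD; apply/eqP; congr _%:R.
    by move: nu_gt0; lia.
  have -> : 2 * (d ord0 / N) * nu.-1%:R = d ord0 - 3 * (d ord0 / N).
    by rewrite mulrAC nuE; field.
  have : 0 <= d ord0 / N by rewrite divr_ge0 // ltW.
  by move: z0; lra.
move=> [y1 y2]; apply/hull_coord.
(* The point e_0, for which [unlift] returns [None], gets weight 0. *)
exists (N^-1 * (0 + N - t) - \sum_j (y 0 j - corner t 0 j)), (t / N),
  (fun i => if unlift ord0 i is Some j then y 0 j - corner t 0 j else 0).
split; first split.
- by rewrite subr_ge0.
- by rewrite divr_ge0 // ltW.
- by move=> i; case: unlift => // j; rewrite subr_ge0.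
- rewrite big_ord_recl unlift_none.
  under [X in _ + (_ + (_ + X))]eq_bigr do rewrite liftK.
  by rewrite (add0r (\sum_i _)) addrCA subrK add0r; field.
- move=> i; case: (unliftP ord0 i) => [j|] ->.
    rewrite row_mx_lift apex_lift mxE rmorphN rmorphM /= !rmorph_nat; ring.
  by rewrite row_mx_ord0 apex0 addr0 divfK.
Qed.

Lemma hull_no_slice (t : R) : t < 0 ->
  [set y | convex_hull R sharp_config (row_mx (const_mx t : 'rV_1) y)] = set0.
Proof.
move=> t0; apply/seteqP; split=> // y /=.
move=> /hull_coord[z [b [d [[z0 b0 d0] s1 xE]]]].
have tE : t = b * N + d ord0 by rewrite -(row_mx_ord0 t y) xE apex0.
by move: t0; rewrite tE ltNge addr_ge0 // mulr_ge0 // ltW.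
Qed.

Lemma normalized_volume_sharp :
  normalized_volume R sharp_config = ((2 * nu + 1)%:R : R)%:E.
Proof.
rewrite /normalized_volume (@lebesgue_rV_slices _ _ _ corner 0 N N^-1).
- rewrite -EFinM; congr EFin; rewrite exprS mulrCA -/N.
  have N0 := N_gt0; have N_neq0 : N != 0 by rewrite gt_eqF.
  rewrite exprVn; field; rewrite expf_neq0 //=.
  by rewrite pnatr_eq0 -lt0n fact_gt0.
- by rewrite invr_gt0.
- exact: ltW.
- by move=> t; exact: lebesgue_rV_corner_simplex.
- exact: hull_slice.
- exact: hull_no_slice.
Qed.
End Volume.
End SharpConfiguration.

(** * The sharp system and its solutions *)

Section LaurentOfTerms.
Variables (R : realType) (n : nat).
Implicit Types (s : seq (R * 'rV[int]_n)).

Definition laurent_of s : laurent R n :=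
  [fsfun b in [fset x in map snd s]%fset => \sum_(t <- s | b == t.2) t.1 | 0].

Lemma finsupp_laurent_of s (C : {fset 'rV[int]_n}) :
  {subset map snd s <= C} -> (finsupp (laurent_of s) `<=` C)%fset.
Proof.
move=> sC; apply/fsubsetP => x /(fsubsetP (finsupp_sub _ _ _)).
by rewrite in_fset => /sC.
Qed.

Lemma laurent_ofE s b : laurent_of s b = \sum_(t <- s | b == t.2) t.1.
Proof.
rewrite fsfunE in_fset; case: ifPn => // bs.
rewrite big_seq_cond big_pred0 // => t; apply: contraNF bs => /andP[ts /eqP ->].
exact: map_f.
Qed.

Lemma laurent_of_eval (K : fieldType) (iota : {rmorphism R -> K}) s x :
  laurent_eval iota (laurent_of s) x = \sum_(t <- s) iota t.1 * monom x t.2.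
Proof.
rewrite (@laurent_evalE _ _ _ _ _ [fset y in map snd s]%fset) ?rmorph0 //; last first.
  by apply: finsupp_laurent_of => y; rewrite in_fset.
under eq_bigr do rewrite laurent_ofE rmorph_sum mulr_suml.
under eq_bigr do rewrite big_mkcond.
rewrite exchange_big /= big_seq [RHS]big_seq; apply: eq_bigr => t ts.
rewrite (big_fsetD1 t.2) /=; last by rewrite in_fset map_f.
rewrite eqxx big1_fset ?addr0 // => y; rewrite in_fsetD1.
by case/andP => /negPf ->.
Qed.
End LaurentOfTerms.

Section SharpSystem.
Variables (R : realType) (m nu : nat).
Local Notation n := m.+1.
Hypotheses (nu_gt0 : (0 < nu)%N) (nu_le : (nu <= n)%N).
Local Notation tail := (tail n nu).
Local Notation apex := (apex m nu).
Local Notation eps := (perturbation R n).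

(** With s = 1 / x_0, dividing each equation by x_0 gives s - c_j for the monomial e_j of the tail,
    1 for the other e_j, s for the point 0 and (s + 1) / eps for the apex. The affine relation of
    the circuit then reads (s + 1) s^2 prod (s - c_j)^2 = eps. *)
Definition sharp_terms (i : 'I_n) : seq (R * 'rV[int]_n) :=
  if i == ord0 then
    [:: (1, apex); (- eps^-1, 0); (- eps^-1, unit_vec ord0)]
  else if i \in tail then
    [:: (1, unit_vec i); (-1, 0); (tail_root nu R i, unit_vec ord0)]
  else [:: (1, unit_vec i); (-1, unit_vec ord0)].

Definition sharp_system (i : 'I_n) : laurent R n := laurent_of (sharp_terms i).

Lemma sharp_system_support : has_support (sharp_config m nu) sharp_system.
Proof.
move=> i; apply: finsupp_laurent_of; apply/allP; rewrite /sharp_terms.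
by case: ifP => _; last case: ifP => _;
  rewrite /= ?mem_apex ?mem_sharp0 ?mem_unit_vec.
Qed.

Section Solutions.
Variables (K : fieldType) (iota : {rmorphism R -> K}).

Lemma monom_unit (x : 'rV[K]_n) j : monom x (unit_vec j) = x 0 j.
Proof.
rewrite /monom (bigD1 j) //= unit_vecE eqxx expr1z big1 ?mulr1 // => i ij.
by rewrite unit_vecE (negPf ij) expr0z.
Qed.

Lemma monom_apex (x : 'rV[K]_n) : monom x apex =
  x 0 ord0 ^+ (2 * nu + 1) / (\prod_(j in tail) x 0 j) ^+ 2.
Proof.
rewrite /monom (bigD1 ord0) //= apex0 -exprnP; congr (_ * _).
rewrite -prodrXl -prodfV [RHS]big_mkcond [RHS](bigD1 ord0) //=.
rewrite (negPf (ord0_tail nu_le)) mul1r; apply: eq_bigr => j j0.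
by rewrite mxE (negPf j0); case: ifP.
Qed.

Definition sharp_solution (s : K) : 'rV[K]_n :=
  \row_j (if j \in tail then (s - tail_root nu K j) / s else s^-1).

Definition solution_poly (s : K) : K :=
  (s + 1) * s ^+ 2 * (\prod_(j in tail) (s - tail_root nu K j)) ^+ 2 - iota eps.

Let eps_neq0 : iota eps != 0.
Proof. by rewrite fmorph_eq0 gt_eqF // perturbation_gt0. Qed.

Lemma solution_poly_neq0 s : solution_poly s = 0 ->
  s != 0 /\ forall j, j \in tail -> s - tail_root nu K j != 0.
Proof.
rewrite /solution_poly => /eqP; rewrite subr_eq0 => /eqP E.
split=> [|j jT]; apply: contraNneq eps_neq0 => s0; rewrite -E.
  by rewrite s0 expr0n mulr0 mul0r.
by rewrite (bigD1 j jT) /= s0 mul0r expr0n mulr0.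
Qed.

Lemma sharp_solution0 s : sharp_solution s 0 ord0 = s^-1.
Proof. by rewrite mxE (negPf (ord0_tail nu_le)). Qed.

Lemma monom_sharp_solution s : s != 0 ->
  monom (sharp_solution s) apex =
  s ^- 3 / (\prod_(j in tail) (s - tail_root nu K j)) ^+ 2.
Proof.
move=> s0; rewrite monom_apex sharp_solution0.
have -> : \prod_(j in tail) sharp_solution s 0 j =
    (\prod_(j in tail) (s - tail_root nu K j)) * s ^- nu.-1.
  rewrite -[in RHS](card_tail nu_gt0 nu_le) -exprVn -prodr_const -big_split /=.
  by apply: eq_bigr => j jT; rewrite mxE jT.
rewrite exprMn invfM mulrCA [RHS]mulrC; congr (_ * _).
(* The nu - 1 tail coordinates, squared, cancel all but three of the powers of s. *)
have -> : (2 * nu + 1 = 3 + nu.-1 * 2)%N by move: nu_gt0; lia.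
rewrite exprD exprM !exprVn invrK -mulrA mulVf ?mulr1 //.
by rewrite !expf_neq0.
Qed.

Lemma sharp_torus_solutions : torus_solutions iota sharp_system =
  sharp_solution @` [set s | solution_poly s = 0].
Proof.
apply/seteqP; split=> [x [x0 xF]|_ [s /= s_root <-]].
  set s := (x 0 ord0)^-1.
  have s0 : s != 0 by rewrite invr_eq0.
  have xE : x = sharp_solution s.
    apply/rowP => j; rewrite mxE; have := xF j.
    rewrite laurent_of_eval /sharp_terms; have [->|j0] := eqVneq j ord0.
      by rewrite (negPf (ord0_tail nu_le)) /s invrK.
    case: ifP => jT; rewrite !big_cons big_nil /= !monom_unit rmorph1 mul1r rmorphN1.
      rewrite monom0 mulr1 addr0 rmorph_nat addrA => /eqP; rewrite addr_eq0 subr_eq.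
      move=> /eqP ->; rewrite /s /tail_root; field.
      by rewrite x0 oner_eq0.
    by rewrite addr0 mulN1r => /eqP; rewrite subr_eq0 /s invrK => /eqP.
  exists s => //=; have := xF ord0; rewrite laurent_of_eval /sharp_terms eqxx.
  rewrite !big_cons big_nil /= monom_unit monom0 rmorph1 mul1r addr0.
  rewrite {1}xE monom_sharp_solution // rmorphN fmorphV mulr1.
  have T0 : \prod_(j in tail) (s - tail_root nu K j) != 0.
    apply/prodf_neq0 => j jT; have := x0 j; rewrite xE mxE jT.
    by apply: contra => /eqP ->; rewrite mul0r.
  rewrite /solution_poly -[x 0 ord0]invrK -/s.
  move: (\prod_(j in tail) _) T0 => T T0 E.
  (* Multiplying by eps s^3 T^2 clears the denominators of s^-3 / T^2 - 1 / eps - 1 / (eps s) =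
     0. *)
  have := congr1 (fun y => y * (iota eps * s ^+ 3 * T ^+ 2)) E; rewrite mul0r => E'.
  have := eps_neq0; move: (iota eps) E' => e E' e0.
  rewrite -[RHS]oppr0 -[in RHS]E'; field.
  by rewrite e0 s0 T0.
have [s0 tail_s] := solution_poly_neq0 s_root; split=> [j|i].
  rewrite mxE; case: ifP => jT; last by rewrite invr_neq0.
  by rewrite mulf_neq0 ?invr_neq0 // tail_s.
rewrite laurent_of_eval /sharp_terms; have [_|i0] := eqVneq i ord0.
  rewrite !big_cons big_nil /= monom_unit monom0 rmorph1 mul1r addr0.
  rewrite monom_sharp_solution // sharp_solution0 rmorphN fmorphV mulr1.
  have T0 : \prod_(j in tail) (s - tail_root nu K j) != 0 by apply/prodf_neq0.
  move: s_root eps_neq0; rewrite /solution_poly.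
  move: (\prod_(j in tail) _) T0 (iota eps) => T T0 e /eqP.
  rewrite subr_eq0 => /eqP <- e0; field.
  have s1 : s + 1 != 0 by apply: contraNneq e0 => ->; rewrite !mul0r.
  by rewrite s0 T0.
case: ifP => iT; rewrite !big_cons big_nil /= !monom_unit rmorph1 mul1r rmorphN1.
  rewrite monom0 mulr1 addr0 sharp_solution0 mxE iT rmorph_nat /tail_root.
  by field.
by rewrite addr0 sharp_solution0 mxE iT mulN1r subrr.
Qed.

Lemma solution_polyE (rs : seq R) s :
  perturbed_poly R n nu = \prod_(r <- rs) ('X - r%:P) ->
  solution_poly s = \prod_(r <- rs) (s - iota r).
Proof.
move=> pE; transitivity (map_poly iota (perturbed_poly R n nu)).[s].
  rewrite /perturbed_poly rmorphB /= map_polyC hornerD hornerN hornerC.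
  congr (_ - _); rewrite /double_root_poly !rmorphM rmorphD /= rmorph_prod.
  rewrite map_polyX rmorph1 !hornerE horner_prod /=.
  have -> : \prod_(j in tail) (map_poly iota ('X - (tail_root nu R j)%:P)).[s] =
      \prod_(j in tail) (s - tail_root nu K j).
    apply: eq_bigr => j _.
    by rewrite rmorphB /= map_polyX map_polyC hornerXsubC /= rmorph_nat.
  by ring.
rewrite pE rmorph_prod horner_prod; apply: eq_bigr => r _.
by rewrite rmorphB /= map_polyX map_polyC hornerXsubC.
Qed.

(** The polynomial splits over [R] with distinct roots, so the count is the same over every
    extension; it is used for the complex numbers and for [R] itself. *)
Lemma card_sharp_solutions :
  torus_solutions iota sharp_system #= `I_(2 * nu + 1).
Proof.
have [rs [uniq_rs size_rs pE]] := perturbed_poly_roots R nu_gt0 nu_le.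
rewrite sharp_torus_solutions.
have -> : [set s | solution_poly s = 0] = [set` [fset x in map iota rs]%fset].
  apply/seteqP; split=> s /=; rewrite (solution_polyE s pE) in_fset.
    move=> /eqP; rewrite prodf_seq_eq0 => /hasP[r rrs /andP[_]].
    by rewrite subr_eq0 => /eqP ->; exact: map_f.
  move=> /mapP[r rrs ->]; apply/eqP; rewrite prodf_seq_eq0; apply/hasP.
  by exists r => //=; rewrite subrr eqxx.
have inj : {in [set` [fset x in map iota rs]%fset] &, injective sharp_solution}.
  by move=> s t _ _ /rowP/(_ ord0); rewrite !sharp_solution0 => /invr_inj.
apply: card_eq_trans (inj_card_eq inj) _.
apply/card_eq_fsetP; rewrite card_fseq undup_id ?size_map //.
by rewrite map_inj_uniq //; exact: fmorph_inj.
Qed.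
End Solutions.

Lemma sharp_generic : generic_system (sharp_config m nu) sharp_system.
Proof.
split; first exact: sharp_system_support.
exists (2 * nu + 1)%N; first exact: (card_sharp_solutions (real_complex R)).
by rewrite normalized_volume_sharp.
Qed.

Lemma card_sharp_real : real_solutions sharp_system #= `I_(2 * nu + 1).
Proof. exact: (card_sharp_solutions (@idfun R)). Qed.

End SharpSystem.

(** * The sharp circuit in the form required by (i) *)

Section SharpVertical.
Variables (m nu : nat).
Local Notation n := m.+1.
Hypotheses (nu_gt1 : (1 < nu)%N) (nu_le : (nu <= n)%N).
Local Notation apex := (apex m nu).

(** The last unit vector serves as l e_n with l = 1, and the apex takes its slot. As nu >= 2, the
    last index lies in the tail and differs from [ord0], so the apex is off the axis. *)
Definition sharp_w (i : 'I_n) : 'rV[int]_n :=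
  if i == ord_max then apex else unit_vec i.

(** Up to its last coordinate, the apex is the combination of the other unit vectors with its own
    coordinates as coefficients. *)
Definition sharp_alpha (i : 'I_n) : int :=
  if i == ord_max then 1 else - apex 0 i.

Let nu_gt0 : (0 < nu)%N. Proof. exact: ltnW. Qed.

Let max_tail : ord_max \in tail n nu.
Proof. by rewrite inE /=; move: nu_gt1; lia. Qed.

Let max_neq0 : ord_max != ord0 :> 'I_n.
Proof. by apply: contraTneq max_tail => ->; exact: ord0_tail. Qed.

Lemma e_lastE (K : pzRingType) j : e_last K n 0 j = (j == ord_max)%:R.
Proof. by rewrite mxE. Qed.

Lemma vertical_sharp_config : vertical_config 1 sharp_w = sharp_config m nu.
Proof.
have eE : 1 *: e_last int n = unit_vec ord_max.
  by rewrite scale1r; apply/rowP => j; rewrite e_lastE unit_vecE.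
apply/fsetP => x; rewrite /vertical_config eE !inE; apply/idP/idP.
  case/orP=> [/orP[->//|/eqP ->]|/imfsetP[i _ ->]].
    by rewrite map_f ?orbT // mem_enum.
  rewrite /sharp_w; case: ifP => _; first by rewrite eqxx orbT.
  by rewrite map_f ?orbT // mem_enum.
case/or3P=> [->//|/eqP ->|/mapP[j _ ->]]; apply/orP.
  right; apply/imfsetP; exists ord_max => //; by rewrite /sharp_w eqxx.
have [->|jm] := eqVneq j ord_max; first by left; rewrite eqxx orbT.
by right; apply/imfsetP; exists j => //; rewrite /sharp_w (negPf jm).
Qed.

Lemma sharp_off_axis (R : realType) : off_vertical_axis R sharp_w.
Proof.
move=> i t /rowP wE; rewrite /sharp_w in wE.
case: eqP wE => [_|/eqP im] wE.
  have := wE ord0; rewrite !mxE eqxx /= [0%N == _]eq_sym.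
  have -> : (m == 0)%N = false.
    by apply: contraNF max_neq0 => /eqP m0; apply/eqP/val_inj.
  by move=> /eqP; rewrite mulr0 intr_eq0; lia.
have := wE i; rewrite !mxE !eqxx /=.
have -> : (i == m :> nat) = false by apply: contraNF im => /eqP im; apply/eqP/val_inj.
by move=> /eqP; rewrite mulr0 oner_eq0.
Qed.

Lemma sharp_coprime : coprime_relation sharp_w sharp_alpha.
Proof.
split; last first.
  by rewrite (bigD1 ord_max) //= /sharp_alpha eqxx gcd1n.
apply/rowP => j; rewrite summxE mxE (bigD1 ord_max) //=.
set j' := widen_ord (leq_pred n) j.
have j'm : j' != ord_max by rewrite -val_eqE /= ltn_eqF.
rewrite (bigD1 j') //= big1 ?addr0 => [|i /andP[im ij]].
  rewrite !mxE /sharp_alpha /sharp_w eqxx (negPf j'm) -/j' unit_vecE eqxx.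
  by rewrite mul1r mulr1 subrr.
rewrite !mxE /sharp_w (negPf im) -/j' unit_vecE.
by rewrite eq_sym (negPf ij) mulr0.
Qed.

Lemma sharp_relation_length : relation_length sharp_alpha = nu.
Proof.
have -> : nu = (#|tail n nu|).+1 by rewrite card_tail // prednK.
rewrite /relation_length.
have -> : [set i | sharp_alpha i != 0]%SET = (ord0 |: tail n nu)%SET.
  apply/setP => i; rewrite !inE /sharp_alpha.
  have [->|im] := eqVneq i ord_max.
    by move: max_tail; rewrite inE => ->; rewrite orbT.
  rewrite oppr_eq0 mxE; have [_|i0] := eqVneq i ord0 => /=; first by lia.
  by rewrite inE; case: ifP.
by rewrite cardsU1 ord0_tail.
Qed.
End SharpVertical.

Theorem theorem5p7 (R : realType) :
  (* (i), bound *)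
  (forall (n : nat) (l : int) (w : 'I_n -> 'rV[int]_n) (alpha : 'I_n -> int)
          (F : 'I_n -> laurent R n),
     (2 <= n)%N -> 1 <= l ->
     is_circuit R (vertical_config l w) -> primitive (vertical_config l w) ->
     off_vertical_axis R w -> coprime_relation w alpha ->
     generic_system (vertical_config l w) F ->
     real_solutions F #<= `I_(2 * relation_length alpha + 1)) /\
  (* (i), sharpness *)
  (forall n nu : nat, (2 <= nu)%N -> (nu <= n)%N ->
     exists (l : int) (w : 'I_n -> 'rV[int]_n) (alpha : 'I_n -> int)
            (F : 'I_n -> laurent R n),
       1 <= l /\
       is_circuit R (vertical_config l w) /\ primitive (vertical_config l w) /\
       off_vertical_axis R w /\ coprime_relation w alpha /\
       relation_length alpha = nu /\
       generic_system (vertical_config l w) F /\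
       real_solutions F #= `I_(2 * nu + 1)) /\
  (* (ii), bound *)
  (forall (n : nat) (C : {fset 'rV[int]_n}) (F : 'I_n -> laurent R n),
     (1 <= n)%N -> is_circuit R C -> primitive C -> generic_system C F ->
     real_solutions F #<= `I_(2 * n + 1)) /\
  (* (ii), sharpness *)
  (forall n : nat, (1 <= n)%N ->
     exists (C : {fset 'rV[int]_n}) (F : 'I_n -> laurent R n),
       is_circuit R C /\ primitive C /\ generic_system C F /\
       real_solutions F #= `I_(2 * n + 1)) /\
  (* (iii) *)
  (forall (n : nat) (C : {fset 'rV[int]_n}),
     is_circuit R C -> primitive C ->
     (exists2 F : 'I_n -> laurent R n,
        generic_system C F & real_solutions F #= `I_(2 * n + 1)) ->
     nondegenerate_config R C).
Proof.
split; first by move=> n l w alpha F; exact: vertical_circuit_real_bound.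
split.
  move=> [|m] nu nu2 nun; first by move: (leq_trans nu2 nun).
  have nu0 : (0 < nu)%N by exact: ltnW.
  exists 1, (@sharp_w m nu), (@sharp_alpha m nu), (@sharp_system R m nu).
  rewrite vertical_sharp_config //; split=> //.
  split; first exact: sharp_is_circuit.
  split; first exact: sharp_primitive.
  split; first exact: sharp_off_axis.
  split; first exact: sharp_coprime.
  split; first exact: sharp_relation_length.
  by split; [exact: sharp_generic|exact: card_sharp_real].
split; first by move=> n C F _; exact: circuit_real_bound_n.
split.
  (* The choice nu = n gives 2 n + 1; it includes n = nu = 1, outside the range 2 <= nu of (i). *)
  move=> [//|m] _; exists (sharp_config m m.+1), (@sharp_system R m m.+1).
  split; first exact: sharp_is_circuit.
  split; first exact: sharp_primitive.
  by split; [exact: sharp_generic|exact: card_sharp_real].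
by move=> n C circ prim [F]; exact: maximal_circuit_nondegenerate.
Qed.
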